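(* Consider the fully discrete DGSEM scheme of polynomial degree $p\ge 1$ with explicit first-order time stepping, $$\omega_i\omega_j J_\kappa^{ij}\,\frac{\mathbf U_\kappa^{ij,n+1}-\mathbf U_\kappa^{ij,n}}{\Delta t^{(n)}}+\mathbf R_\kappa^{ij}(\mathbf u_h^{(n)})=0\qquad\forall \kappa\in X_h,\ 0\le i,j\le p,\ n\ge 0,$$ for the multicomponent compressible Euler system, where the mesh $X_h$, the residuals $\mathbf R_\kappa^{ij}$, the interface flux $\mathbf h$ and the volume flux $\mathbf h_{ec}$ are as defined in the context. (1) Let $n\ge0$ and assume that $\mathbf U_\kappa^{ij,n}\in\Omega^a$ for all $0\le i,j\le p$ and all $\kappa\in X_h$. Then, under the CFL condition $$\Delta t^{(n)}\ \max_{\kappa\in X_h}\ \max_{e\in\partial\kappa}\ \frac{|\partial\kappa_e|}{|e|}\ \max_{0\le k\le p}\ \frac{|\partial\kappa|}{\tilde J_\kappa^k}\ \big|\lambda\big(\mathbf u_h^\pm(\mathbf x_e^k,t^{(n)})\big)\big| \;<\;\frac{1}{2p(p+1)},$$ where $\tilde J_\kappa^k:=\min_{e\in\partial\kappa}J_\kappa(\mathbf x_e^k)$, the cell averages at the next time satisfy $$\langle \mathbf u_h^{(n+1)}\rangle_\kappa\in\Omega^a\qquad\forall\kappa\in X_h .$$ (2) Moreover, the scheme exactly resolves stationary material interfaces at interpolation points: if the initial data is $\mathbf u_0$ with $(\mathbf Y,\rho,\mathbf v,\mathrm p)=(\mathbf Y_L,\rho_L,0,\mathrm p)$ in $\Omega_L$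 and $(\mathbf Y_R,\rho_R,0,\mathrm p)$ in $\Omega_R$, with $\overline{\Omega_L}\cup\overline{\Omega_R}=\overline\Omega$ and the same constant pressure $\mathrm p$ on both sides, and $\mathbf U_\kappa^{ij,0}=\mathbf u_0(\mathbf x_\kappa^{ij})$, then $\mathbf U_\kappa^{ij,n}=\mathbf u_0(\mathbf x_\kappa^{ij})$ for all $\kappa\in X_h$, $0\le i,j\le p$, $n\ge0$.
   Context: **Model.** Let $d=2$, $n_c\ge2$ components, constants $C_{v_i}>0$, $\gamma_i>1$, $C_{p_i}=\gamma_iC_{v_i}$, $r_i=C_{p_i}-C_{v_i}>0$ ($1\le i\le n_c$). The unknown is $\mathbf u=(\rho\mathbf Y^\top,\rho,\rho\mathbf v^\top,\rho E)^\top\in\mathbb R^{n_c+d+1}$ with $\mathbf Y=(Y_1,\dots,Y_{n_c-1})^\top$, $Y_{n_c}=1-\sum_{i<n_c}Y_i$, $e=E-\frac12\mathbf v\cdot\mathbf v$. Mixture laws: $C_p(\mathbf Y)=\sum_{i=1}^{n_c}Y_iC_{p_i}$, $C_v(\mathbf Y)=\sum_{i=1}^{n_c}Y_iC_{v_i}$, $r(\mathbf Y)=C_p(\mathbf Y)-C_v(\mathbf Y)$, $\gamma(\mathbf Y)=C_p(\mathbf Y)/C_v(\mathbf Y)$, temperature $\mathrm T=e/C_v(\mathbf Y)$, pressure $\mathrm p(\mathbf Y,\rho,e)=(\gamma(\mathbf Y)-1)\rho e$, $\theta=1/\mathrm T$, partial densities $\rho_i=\rho\, r(\mathbf Y)/r_i$.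 The system is $\partial_t\mathbf u+\nabla\cdot\mathbf f(\mathbf u)=0$ with $\mathbf f(\mathbf u)\cdot\mathbf n=\big(\rho\mathbf Y^\top\,\mathbf v\cdot\mathbf n,\ \rho\mathbf v\cdot\mathbf n,\ \rho(\mathbf v\cdot\mathbf n)\mathbf v^\top+\mathrm p\,\mathbf n^\top,\ (\rho E+\mathrm p)\mathbf v\cdot\mathbf n\big)^\top$. Set of admissible states: $\Omega^a=\{\mathbf u:\ 0\le Y_i\le1\ (1\le i\le n_c),\ \rho>0,\ e>0\}$. **Volume flux.** With $\overline a=\frac{a^++a^-}2$, $[\![a]\!]=a^+-a^-$, $\widehat a=[\![a]\!]/[\![\ln a]\!]$ (logarithmic mean, $\widehat a=a$ if $a^+=a^-=a$), $\mathbf h_{ec}(\mathbf u^-,\mathbf u^+,\mathbf n)$ has components $h_{\rho Y_i}=\frac{r_{n_c}(\widehat{\rho_{n_c}}-\widehat\rho)}{r(\overline{\mathbf Y})-r_{n_c}}\overline{Y_i}\,\overline{\mathbf v}\cdot\mathbf n$ ($1\le i<n_c$), $h_\rho=\widehat\rho\,\overline{\mathbf v}\cdot\mathbf n$, $\mathbf h_{\rho\mathbf v}=h_\rho\overline{\mathbf v}+\frac{\overline{\mathrm p\theta}}{\overline\theta}\mathbf n$, $h_{\rho E}=\sum_{i=1}^{n_c-1}\frac{C_{v_i}-C_{v_{n_c}}}{\widehat\theta}h_{\rho Y_i}+\big(\frac{C_{v_{n_c}}}{\widehat\theta}+\frac{\mathbf v^-\cdot\mathbf v^+}2\big)h_\rho+\frac{\overline{\mathrm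 p\theta}}{\overline\theta}\overline{\mathbf v}\cdot\mathbf n$; the same formula is used when $\mathbf n$ is not a unit vector. **Interface flux.** Fix $\gamma>\max_{1\le i\le n_c}\gamma_i$ and let $c_\gamma(\rho,\mathrm p)=\sqrt{\gamma\mathrm p/\rho}$, $(\cdot)^+=\max(\cdot,0)$. For $\mathbf u_L,\mathbf u_R\in\Omega^a$ and a unit vector $\mathbf n$, put $u_X=\mathbf v_X\cdot\mathbf n$, $\mathrm p_X=\mathrm p(\mathbf Y_X,\rho_X,e_X)$, $\tau_X=1/\rho_X$ ($X=L,R$). Define the approximate Lagrangian sound speeds $a_L,a_R$ by: if $\mathrm p_R\ge\mathrm p_L$, $\frac{a_L}{\rho_L}=c_\gamma(\rho_L,\mathrm p_L)+\frac{\gamma+1}2\big(\frac{\mathrm p_R-\mathrm p_L}{\rho_Rc_\gamma(\rho_R,\mathrm p_R)}+u_L-u_R\big)^+$ and then $\frac{a_R}{\rho_R}=c_\gamma(\rho_R,\mathrm p_R)+\frac{\gamma+1}2\big(\frac{\mathrm p_L-\mathrm p_R}{a_L}+u_L-u_R\big)^+$; otherwise $\frac{a_R}{\rho_R}=c_\gamma(\rho_R,\mathrm p_R)+\frac{\gamma+1}2\big(\frac{\mathrm p_L-\mathrm p_R}{\rho_Lc_\gamma(\rho_L,\mathrm p_L)}+u_L-u_R\big)^+$ and then $\frac{a_L}{\rho_L}=c_\gamma(\rho_L,\mathrm p_L)+\frac{\gamma+1}2\big(\frac{\mathrm p_R-\mathrm p_L}{a_R}+u_L-u_R\big)^+$.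 Set $S_L=u_L-a_L/\rho_L$, $S_R=u_R+a_R/\rho_R$, $u^\star=\frac{a_Lu_L+a_Ru_R+\mathrm p_L-\mathrm p_R}{a_L+a_R}$, $\mathrm p^\star=\frac{a_R\mathrm p_L+a_L\mathrm p_R+a_La_R(u_L-u_R)}{a_L+a_R}$, $\mathbf v_X^\star=\mathbf v_X+(u^\star-u_X)\mathbf n$, $\tau_L^\star=1/\rho_L^\star=\tau_L+\frac{u^\star-u_L}{a_L}$, $\tau_R^\star=1/\rho_R^\star=\tau_R+\frac{u_R-u^\star}{a_R}$, $E_L^\star=E_L-\frac{\mathrm p^\star u^\star-\mathrm p_Lu_L}{a_L}$, $E_R^\star=E_R-\frac{\mathrm p_Ru_R-\mathrm p^\star u^\star}{a_R}$, and $\mathbf u_X^\star=(\rho_X^\star\mathbf Y_X^\top,\rho_X^\star,\rho_X^\star\mathbf v_X^{\star\top},\rho_X^\star E_X^\star)^\top$. The approximate Riemann solver is $$\mathcal W^r(\tfrac xt;\mathbf u_L,\mathbf u_R,\mathbf n)=\begin{cases}\mathbf u_L,&\tfrac xt<S_L,\\ \mathbf u_L^\star,&S_L<\tfrac xt<u^\star,\\ \mathbf u_R^\star,&u^\star<\tfrac xt<S_R,\\ \mathbf u_R,&S_R<\tfrac xt,\end{cases}$$ and the interface flux is $\mathbf h(\mathbf u^-,\mathbf u^+,\mathbf n)=\mathbf f\big(\mathcal W^r(0;\mathbf u^-,\mathbf u^+,\mathbf n)\big)\cdot\mathbf n$. The wave speed is $|\lambda(\mathbf u)|=|\mathbf v\cdot\mathbf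 n|+a/\rho$ with $a$ the Lagrangian sound speed ($a_L$ or $a_R$) above. In the CFL condition it is taken for both traces $\mathbf u_h^-(\mathbf x_e^k,t^{(n)})$ and $\mathbf u_h^+(\mathbf x_e^k,t^{(n)})$, with $\mathbf n=\mathbf n_e$ and $(\mathbf u_L,\mathbf u_R)=(\mathbf u_h^-,\mathbf u_h^+)$ at $\mathbf x_e^k$. **Mesh and discretization.** The domain $\Omega$ is infinite (no boundary conditions) and is partitioned by a shape-regular mesh $X_h$ of straight-sided quadrilaterals $\kappa$; each $\kappa$ is the image of $[-1,1]^2\ni\boldsymbol\xi=(\xi,\eta)$ by a map $\mathbf x_\kappa$, with Jacobian determinant $J_\kappa>0$. Each edge $e$ is the image of $[-1,1]$ by a map $\mathbf x_e$. Let $-1=\xi_0<\dots<\xi_p=1$ and $\omega_0,\dots,\omega_p>0$ be the $(p+1)$-point Gauss–Lobatto nodes and weights on $[-1,1]$ (so $\omega_0=\omega_p=\frac{2}{p(p+1)}$), $\ell_k$ the associated Lagrange polynomials, $D_{ik}=\ell_k'(\xi_i)$, $\boldsymbol\xi_{ij}=(\xi_i,\xi_j)$, $\mathbf x_\kappa^{ij}=\mathbf x_\kappa(\boldsymbol\xi_{ij})$, $\mathbf x_e^k=\mathbf x_e(\xi_k)$, $J_\kappa^{ij}=J_\kappa$ evaluated at $\boldsymbol\xi_{ij}$; $J_\kappa(\mathbf x_e^k)$ is $J_\kappa$ at the node of $\kappa$ located at $\mathbf x_e^k$. In $\kappa$, $\mathbf u_h$ is the tensor-product polynomial (in $\boldsymbol\xi$)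 of degree $p$ in each direction with nodal values $\mathbf U_\kappa^{ij}=\mathbf u_h(\mathbf x_\kappa^{ij})$; $\mathbf u_h^{(n)}$ and $\mathbf U_\kappa^{ij,n}$ denote values at time $t^{(n)}$, $t^{(n+1)}=t^{(n)}+\Delta t^{(n)}$, $\Delta t^{(n)}>0$. Relative to $\kappa$, for $e\in\partial\kappa$, $\mathbf n_e$ is the unit normal outward to $\kappa$, and $\mathbf u_h^-$, $\mathbf u_h^+$ are the traces on $e$ from inside and outside $\kappa$. Set $\mathbf d(\mathbf x,t)=\mathbf h(\mathbf u_h^-(\mathbf x,t),\mathbf u_h^+(\mathbf x,t),\mathbf n_e)-\mathbf f(\mathbf u_h^-(\mathbf x,t))\cdot\mathbf n_e$ for $\mathbf x\in e$. The residual is $$\mathbf R_\kappa^{ij}(\mathbf u_h)=2\omega_i\omega_j\Big(\sum_{k=0}^pD_{ik}\mathbf h_{ec}(\mathbf U_\kappa^{ij},\mathbf U_\kappa^{kj},\{J_\kappa\nabla\xi\}_{(i,k)j})+\sum_{k=0}^pD_{jk}\mathbf h_{ec}(\mathbf U_\kappa^{ij},\mathbf U_\kappa^{ik},\{J_\kappa\nabla\eta\}_{i(j,k)})\Big)$$ $$+\omega_i\big(J_e^{ip}\delta_{jp}\mathbf d(\mathbf x_\kappa^{ip},t)+J_e^{i0}\delta_{j0}\mathbf d(\mathbf x_\kappa^{i0},t)\big)+\omega_j\big(J_e^{pj}\delta_{ip}\mathbf d(\mathbf x_\kappa^{pj},t)+J_e^{0j}\delta_{i0}\mathbf d(\mathbf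 x_\kappa^{0j},t)\big),$$ where $\{J_\kappa\nabla\xi\}_{(i,k)j}=\frac12(J_\kappa^{ij}\nabla\xi(\boldsymbol\xi_{ij})+J_\kappa^{kj}\nabla\xi(\boldsymbol\xi_{kj}))$, $\{J_\kappa\nabla\eta\}_{i(j,k)}=\frac12(J_\kappa^{ij}\nabla\eta(\boldsymbol\xi_{ij})+J_\kappa^{ik}\nabla\eta(\boldsymbol\xi_{ik}))$, $\nabla$ is the gradient in physical coordinates, $\delta$ is the Kronecker symbol, and each $J_e^{\cdot\cdot}=|e|/2$ with $e$ the edge of $\kappa$ corresponding to the term ($\eta=1$, $\eta=-1$, $\xi=1$, $\xi=-1$ respectively; at a corner node, each of the two terms uses its own edge, normal and outer trace). Cell average: $\langle\mathbf u_h\rangle_\kappa=\sum_{0\le i,j\le p}\omega_i\omega_j\frac{J_\kappa^{ij}}{|\kappa|}\mathbf U_\kappa^{ij}$, with $|\kappa|=\sum_{0\le i,j\le p}\omega_i\omega_jJ_\kappa^{ij}$. $|e|$ is the length of $e$, $|\partial\kappa|=\sum_{e\in\partial\kappa}|e|$. Each $\kappa=\cup_{e\in\partial\kappa}\kappa_e$ is divided into four triangles $\kappa_e$ by joining an interior point to the vertices, $\kappa_e$ being the triangle having $e$ as an edge; $|\partial\kappa_e|$ is its perimeter.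
   Formalization: The interface flux takes the solver pressure p* in the intermediate states u_L*, u_R* instead of the equation of state, for which (1) fails; the 0/0 quotient in h_ρYi is set to the log mean of ρ; points on the interface carry the L or R data. *)

(* Defs.v *)
From HB Require Import structures.
From mathcomp Require Import all_boot all_order all_algebra.
From mathcomp Require Import all_classical all_reals all_analysis.
Set Implicit Arguments.
Unset Strict Implicit.
Unset Printing Implicit Defensive.
Import Order.TTheory GRing.Theory Num.Theory.
Import numFieldNormedType.Exports.
Local Open Scope classical_set_scope.
Local Open Scope ring_scope.

Section Plane.
Variable R : realType.

Definition dotv (a b : 'rV[R]_2) : R := \sum_(i < 2) a 0 i * b 0 i.
(* [`|a|] on row vectors is the sup norm in MathComp-Analysis. *)
Definition enorm (a : 'rV[R]_2) : R := Num.sqrt (dotv a a).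
Definition cross (a b : 'rV[R]_2) : R := a 0 0 * b 0 1 - a 0 1 * b 0 0.
Definition rotcw (a : 'rV[R]_2) : 'rV[R]_2 :=
  \row_(i < 2) (if i == 0 then a 0 1 else - a 0 0).
Definition avg (V : lmodType R) (a b : V) : V := 2^-1 *: (a + b).
Definition avgr (a b : R) : R := (a + b) / 2.
Definition logmean (a b : R) : R :=
  if a == b then a else (b - a) / (ln b - ln a).
Definition pospart (a : R) : R := Num.max a 0.

End Plane.

(* There are m.+1 components; component ord_max is the n_c-th one, and
   component [lift ord_max i], i : 'I_m, is the i-th independent one. *)
Section Gas.
Variables (R : realType) (m : nat).

(* (rho Y_1 .. rho Y_m, rho, rho v, rho E) *)
Definition state : Type := ('rV[R]_m * R^o * 'rV[R]_2 * R^o)%type.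

Definition partial_mass (u : state) : 'rV[R]_m := u.1.1.1.
Definition rho (u : state) : R := u.1.1.2.
Definition momentum (u : state) : 'rV[R]_2 := u.1.2.
Definition rhoE (u : state) : R := u.2.

Definition massfrac (u : state) : 'rV[R]_m := (rho u)^-1 *: partial_mass u.
Definition vel (u : state) : 'rV[R]_2 := (rho u)^-1 *: momentum u.
Definition Etot (u : state) : R := rhoE u / rho u.
Definition eint (u : state) : R := Etot u - dotv (vel u) (vel u) / 2.

Definition fullY (Y : 'rV[R]_m) (i : 'I_m.+1) : R :=
  if unlift ord_max i is Some j then Y 0 j else 1 - \sum_(j < m) Y 0 j.

Definition admissible (u : state) : Prop :=
  [/\ forall i : 'I_m.+1, 0 <= fullY (massfrac u) i <= 1,
      0 < rho u & 0 < eint u].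

Definition mix (C : 'I_m.+1 -> R) (Y : 'rV[R]_m) : R :=
  \sum_(i < m.+1) fullY Y i * C i.

Variables Cv gammai : 'I_m.+1 -> R.
Definition Cpi (i : 'I_m.+1) : R := gammai i * Cv i.
Definition ri (i : 'I_m.+1) : R := Cpi i - Cv i.
Definition mixCv (Y : 'rV[R]_m) : R := mix Cv Y.
Definition mixCp (Y : 'rV[R]_m) : R := mix Cpi Y.
Definition mixr (Y : 'rV[R]_m) : R := mixCp Y - mixCv Y.
Definition mixgamma (Y : 'rV[R]_m) : R := mixCp Y / mixCv Y.

Definition eos (Y : 'rV[R]_m) (d e : R) : R := (mixgamma Y - 1) * d * e.
Definition pressure (u : state) : R := eos (massfrac u) (rho u) (eint u).
Definition temperature (u : state) : R := eint u / mixCv (massfrac u).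
Definition theta (u : state) : R := (temperature u)^-1.
Definition partial_density (i : 'I_m.+1) (u : state) : R :=
  rho u * mixr (massfrac u) / ri i.

Definition flux_with (u : state) (pr : R) (n : 'rV[R]_2) : state :=
  let vn := dotv (vel u) n in
  (vn *: partial_mass u, rho u * vn,
   (rho u * vn) *: vel u + pr *: n, (rhoE u + pr) * vn).
Definition flux (u : state) (n : 'rV[R]_2) : state := flux_with u (pressure u) n.

Section VolumeFlux.
Variables (um up : state) (n : 'rV[R]_2).
Let Yb := avg (massfrac um) (massfrac up).
Let vb := avg (vel um) (vel up).
Let vbn := dotv vb n.
Let rnc := ri ord_max.
Let rhohat := logmean (rho um) (rho up).
Let rhonchat :=
  logmean (partial_density ord_max um) (partial_density ord_max up).
Let thetahat := logmean (theta um) (theta up).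
Let pstar := avgr (pressure um * theta um) (pressure up * theta up)
             / avgr (theta um) (theta up).

(* The quotient is 0/0 when r(Y) = r_nc on both sides. There it is extended by
   rhohat, its value for every pair of states with r(Y^-) = r(Y^+) <> r_nc, so
   that the flux is consistent: h_ec(u,u,n) = f(u).n. *)
Definition hec_ratio : R :=
  if mixr Yb == rnc then rhohat
  else rnc * (rhonchat - rhohat) / (mixr Yb - rnc).
Definition hec_rhoY : 'rV[R]_m := \row_i (hec_ratio * Yb 0 i * vbn).
Definition hec_rho : R := rhohat * vbn.
Definition hec_mom : 'rV[R]_2 := hec_rho *: vb + pstar *: n.
Definition hec_E : R :=
  \sum_(i < m) (Cv (lift ord_max i) - Cv ord_max) / thetahat * hec_rhoY 0 i
  + (Cv ord_max / thetahat + dotv (vel um) (vel up) / 2) * hec_rho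
  + pstar * vbn.
Definition hec : state := (hec_rhoY, hec_rho, hec_mom, hec_E).
End VolumeFlux.

Variable gam : R.
Definition cgam (d pr : R) : R := Num.sqrt (gam * pr / d).

Section InterfaceFlux.
Variables (uL uR : state) (n : 'rV[R]_2).
Let rL := rho uL.
Let rR := rho uR.
Let qL := dotv (vel uL) n.
Let qR := dotv (vel uR) n.
Let pL := pressure uL.
Let pR := pressure uR.
Let cL := cgam rL pL.
Let cR := cgam rR pR.

Definition lag_speeds : R * R :=
  if pL <= pR then
    let aL := rL * (cL + (gam + 1) / 2
                         * pospart ((pR - pL) / (rR * cR) + qL - qR)) in
    let aR := rR * (cR + (gam + 1) / 2
                         * pospart ((pL - pR) / aL + qL - qR)) in
    (aL, aR)
  else
    let aR := rR * (cR + (gam + 1) / 2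
                         * pospart ((pL - pR) / (rL * cL) + qL - qR)) in
    let aL := rL * (cL + (gam + 1) / 2
                         * pospart ((pR - pL) / aR + qL - qR)) in
    (aL, aR).
Let aL := lag_speeds.1.
Let aR := lag_speeds.2.

Definition SL : R := qL - aL / rL.
Definition SR : R := qR + aR / rR.
Definition ustar : R := (aL * qL + aR * qR + pL - pR) / (aL + aR).
Definition pstar : R :=
  (aR * pL + aL * pR + aL * aR * (qL - qR)) / (aL + aR).

Definition mkstate (d : R) (Y : 'rV[R]_m) (v : 'rV[R]_2) (E : R) : state :=
  (d *: Y, d, d *: v, d * E).

Definition ustarL : state :=
  mkstate (rL^-1 + (ustar - qL) / aL)^-1 (massfrac uL)
          (vel uL + (ustar - qL) *: n)
          (Etot uL - (pstar * ustar - pL * qL) / aL).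
Definition ustarR : state :=
  mkstate (rR^-1 + (qR - ustar) / aR)^-1 (massfrac uR)
          (vel uR + (ustar - qR) *: n)
          (Etot uR - (pR * qR - pstar * ustar) / aR).

(* The relaxation solver as a pair (state, pressure). Its pressure is p^* in
   the two intermediate states and p_L, p_R outside, and this is the pressure
   that enters the flux f(W^r(0)).n. By the jump relations of the solver, this
   flux does not depend on the values chosen for W^r at x/t = S_L, u^*, S_R.
   It would if the equation of state were applied to the intermediate states,
   whose pressures then differ across the contact x/t = u^*. *)
Definition riemann (s : R) : state * R :=
  if s < SL then (uL, pL)
  else if s < ustar then (ustarL, pstar)
  else if s < SR then (ustarR, pstar)
  else (uR, pR).

Definition hflux : state := flux_with (riemann 0).1 (riemann 0).2 n.

Definition wave_speedL : R := `|qL| + aL / rL.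
Definition wave_speedR : R := `|qR| + aR / rR.
End InterfaceFlux.

End Gas.

Section Quadrature.
Variables (R : realType) (p : nat).

(* exact on polynomials of degree at most 2p-1, i.e. of size at most 2p *)
Definition gauss_lobatto (xi w : 'I_p.+1 -> R) : Prop :=
  [/\ {homo xi : i j / (i < j)%N >-> i < j},
      xi ord0 = -1, xi ord_max = 1,
      forall i, 0 < w i
    & forall q : {poly R}, (size q <= 2 * p)%N ->
        \int[lebesgue_measure]_(x in `[(-1 : R), 1]) q.[x]
        = \sum_(i < p.+1) w i * q.[xi i] ].

Variable xi : 'I_p.+1 -> R.
Definition lagrange_poly (k : 'I_p.+1) : {poly R} :=
  \prod_(j < p.+1 | j != k) ((xi k - xi j)^-1 *: ('X - (xi j)%:P)).
Definition Dmat (i k : 'I_p.+1) : R := (deriv (lagrange_poly k)).[xi i].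

End Quadrature.

(* South : eta = -1, East : xi = 1, North : eta = 1, West : xi = -1 *)
Variant side := South | East | North | West.
Definition side_code (e : side) : bool * bool :=
  match e with
  | South => (false, false) | East => (false, true)
  | North => (true, false) | West => (true, true)
  end.
Definition side_decode (c : bool * bool) : side :=
  match c with
  | (false, false) => South | (false, true) => East
  | (true, false) => North | (true, true) => West
  end.
Lemma side_codeK : cancel side_code side_decode. Proof. by case. Qed.
HB.instance Definition _ := Finite.copy side (can_type side_codeK).

Section Quadrilateral.
Variable R : realType.

(* [Q a b] is the vertex at xi = 1 if a, -1 otherwise; eta = 1 if b, -1
   otherwise. The straight-sided element is the bilinear image of the square. *)
Definition quad : Type := bool -> bool -> 'rV[R]_2.
Variable Q : quad.

Definition hat (a : bool) (t : R) : R := (if a then 1 + t else 1 - t) / 2.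
Definition qmap (s t : R) : 'rV[R]_2 :=
  \sum_(a : bool) \sum_(b : bool) (hat a s * hat b t) *: Q a b.

Definition jacmx (s t : R) : 'M[R]_2 :=
  \matrix_(i < 2, j < 2)
    (if j == 0 then derive1 (fun z => qmap z t 0 i) s
               else derive1 (fun z => qmap s z 0 i) t).
Definition Jdet (s t : R) : R := \det (jacmx s t).
(* the rows of the inverse Jacobian matrix are the physical gradients *)
Definition Jgrad_xi (s t : R) : 'rV[R]_2 :=
  Jdet s t *: row 0 (invmx (jacmx s t)).
Definition Jgrad_eta (s t : R) : 'rV[R]_2 :=
  Jdet s t *: row 1 (invmx (jacmx s t)).

Definition side_ref (e : side) (t : R) : R * R :=
  match e with
  | South => (t, -1) | East => (1, t) | North => (t, 1) | West => (-1, t)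
  end.

(* counterclockwise, since Jdet > 0 on the elements of a mesh *)
Definition side_start (e : side) : 'rV[R]_2 :=
  match e with
  | South => Q false false | East => Q true false
  | North => Q true true | West => Q false true
  end.
Definition side_end (e : side) : 'rV[R]_2 :=
  match e with
  | South => Q true false | East => Q true true
  | North => Q false true | West => Q false false
  end.

Definition side_len (e : side) : R := enorm (side_end e - side_start e).
Definition side_normal (e : side) : 'rV[R]_2 :=
  (side_len e)^-1 *: rotcw (side_end e - side_start e).
Definition perimeter : R := \sum_(e : side) side_len e.

(* perimeter of the triangle with edge e and apex c *)
Definition tri_perimeter (c : 'rV[R]_2) (e : side) : R :=
  side_len e + enorm (c - side_start e) + enorm (c - side_end e).

Definition in_open_quad (x : 'rV[R]_2) : Prop :=
  exists s t : R, [/\ -1 < s < 1, -1 < t < 1 & x = qmap s t].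
Definition in_quad (x : 'rV[R]_2) : Prop :=
  exists s t : R, [/\ -1 <= s <= 1, -1 <= t <= 1 & x = qmap s t].

(* diameter of the circle inscribed in the triangle x y z *)
Definition indiam (x y z : 'rV[R]_2) : R :=
  2 * `|cross (y - x) (z - x)| / (enorm (y - x) + enorm (z - y) + enorm (x - z)).

(* all distances between vertices are bounded by sigma times the diameter of
   the circle inscribed in any triangle formed by three vertices *)
Definition quad_regular (sigma : R) : Prop :=
  forall a b a' b' c d : bool,
    enorm (Q a b - Q a' b')
    <= sigma * indiam (Q c d) (Q (~~ c) d) (Q c (~~ d)).

End Quadrilateral.

(* A conforming mesh of the whole plane. [nbr k e] is the element on the other
   side of edge e of k, with the name of that edge there. An edge has a single
   parametrization x_e : [-1,1] -> e, common to its two elements: the reference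
   coordinate along side e of k is t, or -t if [flip k e]. *)
Record mesh (R : realType) := Mesh {
  cell : Type;
  geom : cell -> quad R;
  nbr : cell -> side -> cell * side;
  flip : cell -> side -> bool;
  edge_pt := fun (k : cell) (e : side) (t : R) =>
    let r := side_ref e (if flip k e then - t else t) in
    qmap (geom k) r.1 r.2;
  mesh_jac : forall k s t, -1 <= s <= 1 -> -1 <= t <= 1 ->
    0 < Jdet (geom k) s t;
  mesh_cover : forall x, exists k, in_quad (geom k) x;
  mesh_disjoint : forall k k' x,
    in_open_quad (geom k) x -> in_open_quad (geom k') x -> k = k';
  mesh_nbr_neq : forall k e, (nbr k e).1 <> k;
  mesh_nbr_sym : forall k e, nbr (nbr k e).1 (nbr k e).2 = (k, e);
  mesh_nbr_pt : forall k e t, -1 <= t <= 1 ->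
    edge_pt (nbr k e).1 (nbr k e).2 t = edge_pt k e t;
  mesh_regular : exists sigma : R, 0 < sigma /\
    forall k, quad_regular (geom k) sigma
}.

Section Scheme.
Variables (R : realType) (m : nat) (Cv gammai : 'I_m.+1 -> R) (gam : R).
Variables (p : nat) (xi w : 'I_p.+1 -> R) (X : mesh R).

(* u_h only enters the scheme through its nodal values *)
Definition nodal : Type := cell X -> 'I_p.+1 -> 'I_p.+1 -> state R m.

Definition node_pt (k : cell X) (i j : 'I_p.+1) : 'rV[R]_2 :=
  qmap (geom k) (xi i) (xi j).
Definition node_jac (k : cell X) (i j : 'I_p.+1) : R :=
  Jdet (geom k) (xi i) (xi j).
Definition node_Jgrad_xi (k : cell X) (i j : 'I_p.+1) : 'rV[R]_2 :=
  Jgrad_xi (geom k) (xi i) (xi j).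
Definition node_Jgrad_eta (k : cell X) (i j : 'I_p.+1) : 'rV[R]_2 :=
  Jgrad_eta (geom k) (xi i) (xi j).

Definition cell_size (k : cell X) : R :=
  \sum_(i < p.+1) \sum_(j < p.+1) w i * w j * node_jac k i j.
Definition cell_avg (U : nodal) (k : cell X) : state R m :=
  \sum_(i < p.+1) \sum_(j < p.+1)
    (w i * w j * (node_jac k i j / cell_size k)) *: U k i j.

Definition side_node (e : side) (l : 'I_p.+1) : 'I_p.+1 * 'I_p.+1 :=
  match e with
  | South => (l, ord0) | East => (ord_max, l)
  | North => (l, ord_max) | West => (ord0, l)
  end.
(* Exchanges the index along side e of k and the index along x_e; the
   Gauss-Lobatto nodes are symmetric, xi (rev_ord l) = - xi l. *)
Definition reindex (k : cell X) (e : side) (l : 'I_p.+1) : 'I_p.+1 :=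
  if flip k e then rev_ord l else l.
(* the node of k located at x_e^l *)
Definition edge_node (k : cell X) (e : side) (l : 'I_p.+1) :=
  side_node e (reindex k e l).

Definition edge_jac (k : cell X) (e : side) (l : 'I_p.+1) : R :=
  node_jac k (edge_node k e l).1 (edge_node k e l).2.

Section Residual.
Variable U : nodal.

Definition trace_in (k : cell X) (e : side) (l : 'I_p.+1) : state R m :=
  U k (edge_node k e l).1 (edge_node k e l).2.
Definition trace_out (k : cell X) (e : side) (l : 'I_p.+1) : state R m :=
  trace_in (nbr k e).1 (nbr k e).2 l.

Definition edge_d (k : cell X) (e : side) (l : 'I_p.+1) : state R m :=
  let n := side_normal (geom k) e in
  hflux Cv gammai gam (trace_in k e l) (trace_out k e l) n
  - flux Cv gammai (trace_in k e l) n.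
(* J_e d at the node of index i along side e of k *)
Definition side_d (k : cell X) (e : side) (i : 'I_p.+1) : state R m :=
  (side_len (geom k) e / 2) *: edge_d k e (reindex k e i).

Definition delta (i j : 'I_p.+1) : R := (i == j)%:R.

Definition residual (k : cell X) (i j : 'I_p.+1) : state R m :=
  (2 * w i * w j) *:
    (\sum_(l < p.+1) Dmat xi i l *:
        hec Cv gammai (U k i j) (U k l j)
            (avg (node_Jgrad_xi k i j) (node_Jgrad_xi k l j))
     + \sum_(l < p.+1) Dmat xi j l *:
        hec Cv gammai (U k i j) (U k i l)
            (avg (node_Jgrad_eta k i j) (node_Jgrad_eta k i l)))
  + w i *: (delta j ord_max *: side_d k North i
            + delta j ord0 *: side_d k South i)
  + w j *: (delta i ord_max *: side_d k East j
            + delta i ord0 *: side_d k West j).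

Definition Jtilde (k : cell X) (l : 'I_p.+1) : R :=
  \big[Num.min/edge_jac k South l]_(e : side) edge_jac k e l.

Definition edge_speed (k : cell X) (e : side) (l : 'I_p.+1) : R :=
  let n := side_normal (geom k) e in
  Num.max (wave_speedL Cv gammai gam (trace_in k e l) (trace_out k e l) n)
          (wave_speedR Cv gammai gam (trace_in k e l) (trace_out k e l) n).

(* [ctr k] is the interior point joined to the vertices of k *)
Definition cfl_cell (ctr : cell X -> 'rV[R]_2) (k : cell X) : R :=
  \big[Num.max/0]_(e : side)
    (tri_perimeter (geom k) (ctr k) e / side_len (geom k) e
     * \big[Num.max/0]_(l < p.+1)
         (perimeter (geom k) / Jtilde k l * edge_speed k e l)).

(* the mesh is infinite, so the maximum over its elements is a supremum *)
Definition cfl (dt : R) (ctr : cell X -> 'rV[R]_2) : Prop :=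
  (dt%:E * ereal_sup [set (cfl_cell ctr k)%:E | k in [set: cell X]]
   < (1 / (2 * p * p.+1)%:R)%:E)%E.

End Residual.

Definition dgsem_step (dt : R) (U U' : nodal) : Prop :=
  forall k i j,
    (w i * w j * node_jac k i j) *: (dt^-1 *: (U' k i j - U k i j))
    + residual U k i j = 0.

End Scheme.

Definition is_prim (R : realType) (m : nat) (Cv gammai : 'I_m.+1 -> R)
    (u : state R m) (Y : 'rV[R]_m) (d : R) (v : 'rV[R]_2) (pr : R) : Prop :=
  [/\ massfrac u = Y, rho u = d, vel u = v & pressure Cv gammai u = pr].

(* Main.v *)
Require Import Defs.
From HB Require Import structures.
From mathcomp Require Import all_boot all_order all_algebra.
From mathcomp Require Import all_classical all_reals all_analysis.
From mathcomp Require Import zify ring lra.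
Set Implicit Arguments.
Unset Strict Implicit.
Unset Printing Implicit Defensive.
Import Order.TTheory GRing.Theory Num.Theory.
Import numFieldNormedType.Exports.
Local Open Scope classical_set_scope.
Local Open Scope ring_scope.

(* Summing the scheme over the nodes of a cell, summation by parts and the
   symmetry and consistency of h_ec turn the volume terms into the fluxes
   f(u^-).n_e on the boundary, which cancel against d. Hence the cell average is
   updated by interface fluxes only. Admissible states form a convex cone, so it
   is enough to share the nodal values out between the edges (half to each edge
   at a boundary node) and to show that u^- - mu h(u^-, u^+, n) is admissible
   for each edge node. The jump relations of the relaxation solver write h as
   f(u^-).n plus speeds times jumps between consecutive states; grouping by
   states gives a nonnegative combination of the admissible intermediate states
   and (1 - mu a) u^- - mu f(u^-).n, which is admissible when
   mu (|v.n| + c) < 1 - mu a. The value 2 / (p (p + 1)) of the endpoint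
   quadrature weight turns the CFL condition into this bound on mu.
   At a stationary interface every flux reduces to the pressure term (0, p n, 0);
   the interface terms d vanish, and so does the volume term by the discrete
   metric identity D_xi (J grad xi) + D_eta (J grad eta) = 0. *)

(** * Gauss-Lobatto quadrature *)

Section GaussLobatto.
Variables (R : realType) (p : nat).
Hypothesis hp : (1 <= p)%N.
Variables xi w : 'I_p.+1 -> R.
Hypothesis hGL : gauss_lobatto xi w.

Let xi0 : xi ord0 = -1. Proof. by case: hGL. Qed.
Let xip : xi ord_max = 1. Proof. by case: hGL. Qed.
Let w_gt0 i : 0 < w i. Proof. by case: hGL. Qed.

Lemma node_lt (i j : 'I_p.+1) : (i < j)%N -> xi i < xi j.
Proof. by case: hGL => h *; apply: h. Qed.

Lemma node_inj : injective xi.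
Proof.
move=> i j eij; apply: val_inj; case: (ltngtP i j) => // /node_lt;
  by rewrite eij ltxx.
Qed.

Lemma node_bound (i : 'I_p.+1) : -1 <= xi i <= 1.
Proof.
apply/andP; split; [rewrite -xi0|rewrite -xip].
  have [->//|i0] := eqVneq i ord0.
  by apply/ltW; apply: node_lt; rewrite lt0n.
have [->//|ip] := eqVneq i ord_max.
apply/ltW; apply: node_lt; rewrite ltn_neqAle -ltnS ltn_ord andbT.
by apply: contra_neq ip => e; apply: val_inj.
Qed.

Lemma Rintegral_deriv (q : {poly R}) :
  (\int[lebesgue_measure]_(x in `[(-1 : R), 1]) (q^`()%R).[x] = q.[1] - q.[-1])%R.
Proof.
rewrite /Rintegral (@continuous_FTC2 _ _ (horner q)) //.
- by apply: continuous_subspaceT => x; exact: continuous_horner.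
- split.
  + by move=> x _; exact: derivable_horner.
  + by apply: cvg_at_right_filter; exact: continuous_horner.
  + by apply: cvg_at_left_filter; exact: continuous_horner.
- by move=> x _; rewrite derivE.
Qed.

(** Exactness up to degree 2p - 1 covers the derivative of any polynomial of degree at most 2p.
    Every discrete integration by parts goes through this. *)
Lemma quad_deriv (q : {poly R}) : (size q <= (2 * p).+1)%N ->
  \sum_i w i * q^`().[xi i] = q.[1] - q.[-1].
Proof.
move=> sq; rewrite -Rintegral_deriv.
case: hGL => _ _ _ _ ->//.
rewrite (leq_trans (size_poly _ _))//.
by move: sq; case: (size q).
Qed.

Lemma size_mul_le (a b : {poly R}) (n n' : nat) :
  (size a <= n)%N -> (size b <= n')%N -> (size (a * b)%R <= (n + n').-1)%N.
Proof.
move=> ha hb; rewrite (leq_trans (size_polyMleq _ _))//.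
by rewrite -!subn1 leq_sub2r// leq_add.
Qed.

Lemma poly0_of_nodes (q : {poly R}) :
  (size q <= p.+1)%N -> (forall i, q.[xi i] = 0) -> q = 0.
Proof.
move=> sq qz; apply/eqP; apply: contraTT isT => q0.
have := @max_poly_roots _ q [seq xi i | i <- enum 'I_p.+1] q0.
rewrite size_map size_enum_ord map_inj_uniq ?enum_uniq; last exact: node_inj.
rewrite ltnNge sq => -> //.
by apply/allP => _ /mapP[i _ ->]; apply/rootP.
Qed.

Lemma lagrange_node k i : (lagrange_poly xi k).[xi i] = (i == k)%:R.
Proof.
rewrite horner_prod; have [->|ik] := eqVneq i k.
  rewrite big1// => j jk; rewrite hornerZ !hornerE mulVf//.
  by rewrite subr_eq0 (inj_eq node_inj) eq_sym.
by rewrite (bigD1 i)//= hornerZ !hornerE subrr mulr0 mul0r.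
Qed.

Lemma size_lagrange k : (size (lagrange_poly xi k) <= p.+1)%N.
Proof.
rewrite (leq_trans (size_prod_leq _ _))//=.
have -> : #|[pred j | j != k]| = p by rewrite cardC1 card_ord.
rewrite leq_subLR addnS ltnS.
have : (\sum_(i < p.+1 | i != k) size ((xi k - xi i)^-1 *: ('X - (xi i)%:P))
   <= \sum_(i < p.+1 | i != k) 2)%N.
  apply: leq_sum => i _; rewrite (leq_trans (size_scale_leq _ _))//.
  by rewrite size_XsubC.
move/leq_trans; apply; rewrite sum_nat_const.
have -> : #|[pred j | j != k]| = p by rewrite cardC1 card_ord.
lia.
Qed.

(** A polynomial of degree at most p is its own Lagrange interpolant at the p + 1 distinct nodes;
    the interpolant is differentiated. *)
Lemma Dmat_exact (q : {poly R}) i : (size q <= p.+1)%N ->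
  \sum_k Dmat xi i k * q.[xi k] = q^`().[xi i].
Proof.
move=> sq; suff e : q = \sum_k q.[xi k] *: lagrange_poly xi k.
  rewrite [in RHS]e (linear_sum (@deriv R)) horner_sum; apply: eq_bigr => k _.
  by rewrite /= derivZ hornerZ mulrC.
apply/eqP; rewrite -subr_eq0; apply/eqP/poly0_of_nodes => [|i'].
  rewrite (leq_trans (size_polyD _ _))// geq_max sq size_polyN.
  apply: (leq_trans (size_sum _ _ _)); apply/bigmax_leqP => k _.
  by rewrite (leq_trans (size_scale_leq _ _))// size_lagrange.
rewrite hornerD hornerN horner_sum (bigD1 i')//= hornerZ lagrange_node eqxx.
rewrite big1 ?addr0 ?mulr1 ?subrr// => k ki.
by rewrite hornerZ lagrange_node eq_sym (negPf ki) mulr0.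
Qed.

(** The left side is the quadrature of the derivative of a product of two Lagrange polynomials. The
    product has degree at most 2p, so the rule is exact and only endpoint values remain. *)
Lemma sbp (i j : 'I_p.+1) : w i * Dmat xi i j + w j * Dmat xi j i =
  ((i == ord_max) && (j == ord_max))%:R - ((i == ord0) && (j == ord0))%:R.
Proof.
have /quad_deriv : (size (lagrange_poly xi i * lagrange_poly xi j)%R <= (2 * p).+1)%N.
  apply: leq_trans (size_mul_le (size_lagrange i) (size_lagrange j)) _; lia.
rewrite -{1}xip -xi0 !hornerM !lagrange_node -!natrM !mulnb.
rewrite !(eq_sym ord0) !(eq_sym ord_max) => <-.
rewrite derivM.
under eq_bigr do rewrite hornerD !hornerM !lagrange_node mulrDr.
rewrite big_split/= addrC; congr (_ + _).
  rewrite (bigD1 i)//= eqxx mul1r big1 ?addr0// => k kj.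
  by rewrite (negPf kj) mul0r mulr0.
rewrite (bigD1 j)//= eqxx mulr1 big1 ?addr0// => k kj.
by rewrite (negPf kj) !mulr0.
Qed.

(** * The nodal polynomial and the endpoint weight *)

Let N : {poly R} := \prod_(i < p.+1 | (i != ord0) && (i != ord_max)) ('X - (xi i)%:P).
(** Up to sign, the monic polynomial whose roots are all the nodes: [N] carries the interior ones
    and 1 - X^2 the endpoints. *)
Let Z : {poly R} := (1 - 'X^2) * N.

Let ends_neq : (ord_max : 'I_p.+1) != ord0.
Proof. by rewrite -val_eqE /= -lt0n. Qed.

Let cardN : #|[pred i : 'I_p.+1 | (i != ord0) && (i != ord_max)]| = p.-1.
Proof.
have := cardD1 ord_max [pred i : 'I_p.+1 | i != ord0].
rewrite inE ends_neq cardC1 card_ord => e.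
rewrite [p.-1](_ : _ = #|[predD1 [pred i : 'I_p.+1 | i != ord0] & ord_max]|).
  by apply: eq_card => i; rewrite !inE andbC.
exact: (congr1 predn e).
Qed.

Let sizeN : size N = p.
Proof.
rewrite /N -big_filter size_prod_XsubC -[RHS](prednK hp) -cardN.
by rewrite size_filter -sum1_count sum1_card.
Qed.

Let monicN : N \is monic.
Proof. by apply: monic_prod => i _; exact: monicXsubC. Qed.

Let N_node i : i != ord0 -> i != ord_max -> N.[xi i] = 0.
Proof.
move=> i0 ip; rewrite horner_prod (bigD1 i) ?i0 ?ip//=.
by rewrite !hornerE subrr mul0r.
Qed.

Let N_end i : (i == ord0) || (i == ord_max) -> N.[xi i] != 0.
Proof.
move=> ie; rewrite horner_prod prodf_seq_neq0; apply/allP => j _ /=.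
apply/implyP => /andP[j0 jp]; rewrite !hornerE subr_eq0 (inj_eq node_inj).
by case/orP: ie => /eqP->; rewrite eq_sym.
Qed.

Let Z_node i : Z.[xi i] = 0.
Proof.
have [->|i0] := eqVneq i ord0; first by rewrite /Z xi0 !hornerE; ring.
have [->|ip] := eqVneq i ord_max; first by rewrite /Z xip !hornerE; ring.
by rewrite /Z hornerM N_node// mulr0.
Qed.

Let size1X2 (t : {poly R}) n : (size t <= n)%N -> (size ((1 - 'X^2) * t)%R <= n.+2)%N.
Proof.
move=> st; suff s3 : (size (1 - 'X^2 : {poly R})%R <= 3)%N.
  exact: leq_trans (size_mul_le s3 st) _.
by rewrite (leq_trans (size_polyD _ _))// size_polyN size_polyXn size_poly1.
Qed.

Let sizeZ : (size Z <= p.+2)%N.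
Proof. by apply: size1X2; rewrite sizeN. Qed.

(* Up to a constant, Z' is the Legendre polynomial of degree p: the discrete
   inner product sees [Z' t] as an integration by parts, since Z vanishes at
   every node. *)
Let Z'_orth (t : {poly R}) : (size t <= p)%N ->
  \sum_i w i * (Z^`() * t).[xi i] = 0.
Proof.
move=> st; have /quad_deriv : (size (Z * t)%R <= (2 * p).+1)%N.
  by apply: leq_trans (size_mul_le sizeZ st) _; lia.
rewrite -[X in (Z * t).[X] - _]xip -[X in _ - (Z * t).[X]]xi0.
rewrite ![(Z * t).[_]]hornerM.
rewrite !Z_node !mul0r subrr => e0; rewrite -[RHS]e0.
apply: eq_bigr => i _; rewrite derivM hornerD; congr (_ * _).
by rewrite [X in _ + X]hornerM Z_node mul0r addr0.
Qed.

Let size_deriv (q : {poly R}) n : (size q <= n.+1)%N -> (size q^`() <= n)%N.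
Proof.
move=> sq; rewrite (leq_trans (size_poly _ _))//; move: sq; by case: (size q).
Qed.

Let coefZp : Z`_p.+1 = -1.
Proof.
rewrite /Z mulrBl mul1r coefB coefXnM.
have -> : N`_p.+1 = 0 by rewrite nth_default// sizeN.
have e : (p.+1 - 2)%N = (size N).-1 by rewrite sizeN; lia.
by rewrite ltnNge /= ltnS hp /= e -lead_coefE (monicP monicN) sub0r.
Qed.

(** This is Legendre's differential equation. The defect [t] has degree at most p - 2, and a
    discrete energy identity makes (1 - X^2) t vanish at all p + 1 nodes, hence identically. *)
Let Z''N : Z^`()^`() = - (p * p.+1)%:R *: N.
Proof.
pose t : {poly R} := Z^`()^`() + (p * p.+1)%:R *: N.
suff t0 : t = 0 by apply/eqP; rewrite -subr_eq0 scaleNr opprK; apply/eqP.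
(* The leading terms cancel: that of Z is -X^(p+1) and that of N is X^(p-1). *)
have st : (size t <= p.-1)%N.
  apply/leq_sizeP => j; rewrite -(prednK hp) /= => pj.
  rewrite coefD coefZ !coef_deriv.
  have [jp|jp] := eqVneq j p.-1.
    rewrite jp (prednK hp) coefZp.
    have -> : N`_p.-1 = 1 by rewrite -[p in p.-1]sizeN -lead_coefE (monicP monicN).
    by rewrite -mulrnA mulNrn mulr1 mulnC addNr.
  have pj' : (p <= j)%N by lia.
  rewrite (nth_default 0 (s := N)) ?sizeN// mulr0 addr0.
  by rewrite nth_default ?mul0rn// (leq_trans sizeZ); lia.
suff /eqP : (1 - 'X^2) * t = 0.
  rewrite mulf_eq0 => /orP[|/eqP//].
  move=> /eqP/(congr1 (fun q : {poly R} => q.[0])).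
  by rewrite !hornerE => /eqP; rewrite expr0n subr0 oner_eq0.
apply: poly0_of_nodes => [|i]; first by rewrite (leq_trans (size1X2 st))//; lia.
(* Since (1 - X^2) N = Z is zero at the nodes, t and Z'' agree there under the factor 1 - X^2. *)
have tZ i' : ((1 - 'X^2) * t).[xi i'] = ((1 - 'X^2) * Z^`()^`()).[xi i'].
  have := Z_node i'; rewrite /Z !hornerM /t => h.
  by rewrite [(_ + _ *: _).[_]]hornerD hornerZ mulrDr mulrCA h mulr0 addr0.
(* Quadrature of (Z' s)' with s = (1 - X^2) t. There is no boundary term since s vanishes at both
   ends, and Z' s' contributes nothing by [Z'_orth]. What is left is a sum of nonnegative terms. *)
have s0 : \sum_i' w i' * (1 - xi i' ^+ 2) * t.[xi i'] ^+ 2 = 0.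
  pose s : {poly R} := (1 - 'X^2) * t; have ss := size1X2 st; rewrite -/s in ss.
  have sx x : s.[x] = (1 - x ^+ 2) * t.[x] by rewrite /s !hornerE.
  have /quad_deriv : (size (Z^`() * s)%R <= (2 * p).+1)%N.
    by apply: leq_trans (size_mul_le (size_deriv sizeZ) ss) _; lia.
  rewrite ![(Z^`() * s).[_]]hornerM !sx sqrrN expr1n subrr !(mul0r, mulr0) subrr.
  move=> e0; rewrite -[RHS]e0 derivM.
  under [RHS]eq_bigr do rewrite hornerD mulrDr.
  rewrite big_split/= [X in _ + X]Z'_orth ?addr0; last first.
    by apply: size_deriv; apply: leq_trans ss _; lia.
  apply: eq_bigr => i' _; rewrite hornerM sx.
  have := tZ i'; rewrite !hornerM !hornerE => h.
  set c := 1 - _ in h *; set d := Z^`()^`().[_] + _ in h *; rewrite /=.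
  transitivity (w i' * (c * d) * d); first by rewrite !mulrA.
  by rewrite h -!mulrA; congr (_ * _); rewrite mulrCA.
have xb i' : 0 <= 1 - xi i' ^+ 2.
  by have /andP[] := node_bound i'; nra.
have {}s0 := psumr_eq0P (fun i' _ => mulr_ge0 (mulr_ge0 (ltW (w_gt0 i')) (xb i'))
  (sqr_ge0 (t.[xi i']))) s0.
have /eqP := s0 i isT.
rewrite !mulf_eq0 orbb gt_eqF//= hornerM => /orP[] /eqP e.
  have -> : (1 - 'X^2).[xi i] = 0 by rewrite !hornerE -[RHS]e.
  by rewrite mul0r.
by rewrite e mulr0.
Qed.

(* The endpoint weight comes out of the quadrature of the derivative of
   [(1 + x X) N Z'] at the endpoint [x = 1] or [x = -1]. *)
Lemma w_end i : (i == ord0) || (i == ord_max) -> w i = 2 / (p * p.+1)%:R.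
Proof.
move=> ie; set x := xi i.
have x1 : x = 1 \/ x = -1.
  by case/orP: ie => /eqP e; rewrite /x e ?xi0 ?xip; [right|left].
have Nx := N_end ie; rewrite -/x in Nx.
pose q : {poly R} := (1 + x *: 'X) * N * Z^`().
have sl : (size (1 + x *: 'X : {poly R})%R <= 2)%N.
  rewrite (leq_trans (size_polyD _ _))// geq_max size_poly1/=.
  by rewrite (leq_trans (size_scale_leq _ _))// size_polyX.
have /quad_deriv : (size q <= (2 * p).+1)%N.
  have sN : (size N <= p)%N by rewrite sizeN.
  by apply: leq_trans (size_mul_le (size_mul_le sl sN) (size_deriv sizeZ)) _; lia.
have Z'x : Z^`().[x] = - (2 * x * N.[x]).
  rewrite /Z !poly.derivE !hornerE.
  by case: x1 => ->; ring.
(* The factor 1 + x X equals 2 at the endpoint x and kills the other endpoint. *)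
have -> : q.[1] - q.[-1] = - 4 * N.[x] ^+ 2.
  have lA y : (1 + x *: 'X).[y] = 1 + x * y by rewrite !hornerE.
  rewrite /q !hornerM !lA.
  case: x1 Z'x => -> Z'x; rewrite Z'x; ring.
rewrite /q derivM.
under eq_bigr do rewrite hornerD mulrDr.
rewrite big_split/= [in X in X + _](eq_bigr (fun j =>
  w j * (Z^`() * ((1 + x *: 'X) * N)^`()).[xi j])); last first.
  by move=> j _; rewrite [in RHS](mulrC Z^`()).
rewrite Z'_orth ?add0r; last first.
  apply: size_deriv; have sN : (size N <= p)%N by rewrite sizeN.
  by apply: leq_trans (size_mul_le sl sN) _; lia.
(* Only node i survives: N vanishes at the interior nodes and 1 + x X at the opposite endpoint. This
   leaves 2 p (p + 1) w_i N(x)^2 = 4 N(x)^2. *)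
rewrite (bigD1 i)//= big1 ?addr0; last first.
  move=> j ji; rewrite Z''N !hornerM.
  have [jx|jx] := boolP ((j == ord0) || (j == ord_max)).
    have -> : (1 + x *: 'X).[xi j] = 0; last by rewrite !mul0r mulr0.
    rewrite !hornerE /x.
    case/orP: ie ji jx => /eqP-> ji /orP[] /eqP e; move: ji;
      rewrite e ?eqxx ?xi0 ?xip// => _; ring.
  by move: jx; rewrite negb_or => /andP[? ?]; rewrite N_node// mulr0 mul0r mulr0.
have xx : x * x = 1 by case: x1 => ->; ring.
rewrite -/x Z''N !hornerM hornerZ hornerD hornerZ hornerX hornerC xx.
have : (p * p.+1)%:R != 0 :> R by rewrite pnatr_eq0 muln_eq0 negb_or -lt0n hp.
move: Nx; set n := N.[x]; set K := (p * p.+1)%:R => n0 K0 h.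
clearbody n K.
apply: (mulIf (mulf_neq0 K0 (mulf_neq0 n0 n0))).
transitivity (2 * (n * n)); last by field.
lra.
Qed.
End GaussLobatto.

(** * The convex cone of admissible states *)

Section PlaneTheory.
Variable R : realType.
Implicit Types a b c n : 'rV[R]_2.

Lemma dotvE a b : dotv a b = a 0 0 * b 0 0 + a 0 1 * b 0 1.
Proof.
rewrite /dotv !big_ord_recl big_ord0 addr0.
by congr (_ + _ * _ ); congr (_ _ _); apply: val_inj.
Qed.

Lemma dotvC a b : dotv a b = dotv b a.
Proof. by rewrite !dotvE; ring. Qed.

Lemma dotvDl a b c : dotv (a + b) c = dotv a c + dotv b c.
Proof. by rewrite !dotvE !mxE; ring. Qed.

Lemma dotvZl (x : R) a b : dotv (x *: a) b = x * dotv a b.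
Proof. by rewrite !dotvE !mxE; ring. Qed.

Lemma dotvDr a b c : dotv a (b + c) = dotv a b + dotv a c.
Proof. by rewrite !dotvE !mxE; ring. Qed.

Lemma dotvZr (x : R) a b : dotv a (x *: b) = x * dotv a b.
Proof. by rewrite !dotvE !mxE; ring. Qed.

Lemma dotv_ge0 a : 0 <= dotv a a.
Proof. by rewrite dotvE; nra. Qed.

Lemma dotv0l a : dotv 0 a = 0.
Proof. by rewrite dotvE !mxE !mul0r addr0. Qed.

Lemma dotv_shift a n (x : R) : dotv n n = 1 ->
  dotv (a + x *: n) (a + x *: n) = dotv a a + 2 * x * dotv a n + x ^+ 2.
Proof.
by move=> n1; rewrite dotvDl !dotvDr !dotvZl !dotvZr n1 (dotvC n); ring.
Qed.

End PlaneTheory.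

Section GasTheory.
Variables (R : realType) (m : nat).
Implicit Types (u v : state R m) (Y : 'rV[R]_m).

Lemma fullY_sum Y : \sum_i fullY Y i = 1.
Proof.
rewrite (bigD1_ord ord_max)//= /fullY unlift_none.
by under eq_bigr do rewrite liftK; rewrite subrK.
Qed.

Lemma mix_gt0 (C : 'I_m.+1 -> R) Y : (forall i, 0 < C i) ->
  (forall i, 0 <= fullY Y i) -> 0 < mix C Y.
Proof.
move=> C0 Y0; rewrite lt_neqAle sumr_ge0 ?andbT; last first.
  by move=> i _; rewrite mulr_ge0// ltW.
apply/negP => /eqP/esym h.
have z i : fullY Y i = 0.
  have hz := psumr_eq0P (fun i _ => mulr_ge0 (Y0 i) (ltW (C0 i))) h.
  have /eqP := hz i isT.
  by rewrite mulf_eq0 (gt_eqF (C0 i)) orbF => /eqP.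
have := fullY_sum Y; rewrite big1//; move=> /esym/eqP; by rewrite oner_eq0.
Qed.

(** Homogeneous conditions on the conserved variables, which exhibit the cone. The last one says 2
    rho^2 e > 0. *)
Definition cons_admissible u : Prop :=
  [/\ forall i, 0 <= partial_mass u 0 i,
      \sum_i partial_mass u 0 i <= rho u,
      0 < rho u & dotv (momentum u) (momentum u) < 2 * rho u * rhoE u].

Lemma eintE u : rho u != 0 ->
  eint u = (2 * rho u * rhoE u - dotv (momentum u) (momentum u)) / (2 * rho u ^+ 2).
Proof. by move=> r0; rewrite /eint /Etot /vel dotvZl dotvZr; field. Qed.

Lemma admissibleP u : admissible u <-> cons_admissible u.
Proof.
have YE i : massfrac u 0 i = partial_mass u 0 i / rho u by rewrite mxE mulrC.
have sY : \sum_j massfrac u 0 j = (\sum_j partial_mass u 0 j) / rho u.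
  by rewrite mulr_suml; apply: eq_bigr.
split=> [[hY r0 he]|[hm hs r0 he]].
  split=> //.
  - move=> i; have /andP[] := hY (lift ord_max i).
    by rewrite /fullY liftK YE pmulr_lge0 ?invr_gt0.
  - have /andP[] := hY ord_max.
    by rewrite /fullY unlift_none sY subr_ge0 ler_pdivrMr// mul1r.
  - move: he; rewrite eintE ?gt_eqF// pmulr_lgt0 ?subr_gt0//.
    by rewrite invr_gt0 mulr_gt0// exprn_gt0.
have Y0 i : 0 <= fullY (massfrac u) i.
  rewrite /fullY; case: unliftP => [j _|_]; first by rewrite YE divr_ge0// ltW.
  by rewrite sY subr_ge0 ler_pdivrMr// mul1r.
split=> //.
  move=> i; rewrite Y0 /= -(fullY_sum (massfrac u)) (bigD1 i)//= lerDl.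
  by rewrite sumr_ge0.
rewrite eintE ?gt_eqF// divr_gt0 ?subr_gt0//.
by rewrite mulr_gt0// exprn_gt0.
Qed.

Lemma admissibleZ (t : R) u : 0 < t -> admissible u -> admissible (t *: u).
Proof.
move=> t0 /admissibleP[hm hs r0 he]; apply/admissibleP.
have mE i : partial_mass (t *: u) 0 i = t * partial_mass u 0 i by rewrite !mxE.
have rE : rho (t *: u) = t * rho u by [].
have EE : rhoE (t *: u) = t * rhoE u by [].
split.
- by move=> i; rewrite mE mulr_ge0// ltW.
- by under eq_bigr do rewrite mE; rewrite -mulr_sumr rE ler_pM2l.
- by rewrite rE mulr_gt0.
- rewrite rE EE dotvZl dotvZr -subr_gt0.
  have -> : 2 * (t * rho u) * (t * rhoE u) - t * (t * dotv (momentum u) (momentum u))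
    = t * t * (2 * rho u * rhoE u - dotv (momentum u) (momentum u)) by ring.
  by rewrite mulr_gt0 ?mulr_gt0 ?subr_gt0.
Qed.

(* The perspective function |m|^2 / rho is subadditive. *)
Lemma admissibleD u v : admissible u -> admissible v -> admissible (u + v).
Proof.
move=> /admissibleP[hm hs r0 he] /admissibleP[hm' hs' r0' he'].
apply/admissibleP.
have mE i : partial_mass (u + v) 0 i = partial_mass u 0 i + partial_mass v 0 i.
  by rewrite !mxE.
have rE : rho (u + v) = rho u + rho v by [].
have EE : rhoE (u + v) = rhoE u + rhoE v by [].
split.
- by move=> i; rewrite mE addr_ge0.
- by under eq_bigr do rewrite mE; rewrite big_split/= rE lerD.
- by rewrite rE addr_gt0.
- have -> : momentum (u + v) = momentum u + momentum v by [].
  rewrite rE EE; move: r0 r0' he he'; rewrite !dotvE !mxE.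
  set a := momentum u 0 0; set b := momentum u 0 1.
  set c := momentum v 0 0; set d := momentum v 0 1.
  move: (rho u) (rho v) (rhoE u) (rhoE v) => r s E F r0 s0 hE hF.
  clearbody a b c d; clear -r0 s0 hE hF.
  have rs : 0 < r * s by exact: mulr_gt0.
  rewrite -(ltr_pM2l rs) -subr_gt0.
  (* After multiplication by r s, the energy gap of the sum is a positive combination of the two
     given gaps plus squares that measure the velocity difference. *)
  have -> : r * s * (2 * (r + s) * (E + F)) -
      r * s * ((a + c) * (a + c) + (b + d) * (b + d))
    = (s * (r + s)) * (2 * r * E - (a * a + b * b))
    + (r * (r + s)) * (2 * s * F - (c * c + d * d))
    + ((s * a - r * c) ^+ 2 + (s * b - r * d) ^+ 2) by ring.
  apply: ltr_wpDr; first by rewrite addr_ge0 ?sqr_ge0.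
  by rewrite addr_gt0// mulr_gt0 ?subr_gt0// mulr_gt0// addr_gt0.
Qed.

(** The origin is not admissible, its density being 0. Adjoining it allows summands of weight
    zero. *)
Definition admissible0 u := u = 0 \/ admissible u.

Lemma admissible0D u v : admissible0 u -> admissible0 v -> admissible0 (u + v).
Proof.
move=> [->|hu]; first by rewrite add0r.
by move=> [->|hv]; right; [rewrite addr0|exact: admissibleD].
Qed.

Lemma admissibleDl u v : admissible u -> admissible0 v -> admissible (u + v).
Proof. by move=> hu [->|]; [rewrite addr0|exact: admissibleD]. Qed.

Lemma admissible0Z (t : R) u : 0 <= t -> admissible0 u -> admissible0 (t *: u).
Proof.
rewrite le_eqVlt => /orP[/eqP<-|t0]; first by rewrite scale0r; left.
by move=> [->|hu]; [left; rewrite scaler0|right; exact: admissibleZ].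
Qed.

Lemma admissible0_sum (I : finType) (F : I -> state R m) :
  (forall i, admissible0 (F i)) -> admissible0 (\sum_i F i).
Proof.
move=> hF; apply: big_ind => //; first by left.
exact: admissible0D.
Qed.

Lemma admissible_sum (I : finType) (i : I) (F : I -> state R m) :
  (forall i, admissible (F i)) -> admissible (\sum_i F i).
Proof.
move=> hF; rewrite (bigD1 i)//=; apply: admissibleDl => //.
apply: big_ind => //; [by left|exact: admissible0D|by move=> j _; right].
Qed.

(** * Pressure and sound speed of admissible states *)

Variables Cv gammai : 'I_m.+1 -> R.
Hypotheses (hCv : forall i, 0 < Cv i) (hgammai : forall i, 1 < gammai i).

Lemma mixCv_gt0 u : admissible u -> 0 < mixCv Cv (massfrac u).
Proof. by case=> hY _ _; apply: mix_gt0 => // i; case/andP: (hY i). Qed.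

Lemma mixrE Y : mixr Cv gammai Y = mix (ri Cv gammai) Y.
Proof.
rewrite /mixr /mixCp /mixCv /mix -sumrB; apply: eq_bigr => i _.
by rewrite -mulrBr.
Qed.

Lemma ri_gt0 i : 0 < ri Cv gammai i.
Proof. by rewrite /ri /Cpi subr_gt0 -{1}[Cv i]mul1r ltr_pM2r. Qed.

Lemma mixr_gt0 u : admissible u -> 0 < mixr Cv gammai (massfrac u).
Proof.
case=> hY _ _; rewrite mixrE; apply: mix_gt0 => [i|i]; first exact: ri_gt0.
by case/andP: (hY i).
Qed.

Lemma pressureE u : admissible u ->
  pressure Cv gammai u = mixr Cv gammai (massfrac u) / mixCv Cv (massfrac u)
    * rho u * eint u.
Proof.
move=> hu; rewrite /pressure /eos /mixgamma /mixr; congr (_ * _ * _).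
by rewrite mulrBl divff// gt_eqF// mixCv_gt0.
Qed.

Lemma pressure_gt0 u : admissible u -> 0 < pressure Cv gammai u.
Proof.
move=> hu; rewrite pressureE//; case: (hu) => _ r0 e0.
by rewrite !mulr_gt0// ?invr_gt0 ?mixr_gt0 ?mixCv_gt0.
Qed.

Variable gam : R.
Hypothesis hgam : forall i, gammai i < gam.

Lemma gam_gt1 : 1 < gam.
Proof. exact: lt_trans (hgammai ord0) (hgam ord0). Qed.

(** Each r_i = (gamma_i - 1) C_v_i is at most [gam * Cv i], and the bound survives averaging over
    the mass fractions. *)
Lemma pressure_le u : admissible u ->
  pressure Cv gammai u <= gam * (rho u * eint u).
Proof.
move=> hu; rewrite pressureE//; case: (hu) => hY r0 e0.
have C0 := mixCv_gt0 hu.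
rewrite -mulrA ler_pM2r; last exact: mulr_gt0.
rewrite ler_pdivrMr// mixrE /mixCv /mix mulr_sumr ler_sum// => i _.
have /andP[Yi _] := hY i.
rewrite mulrCA ler_wpM2l// /ri /Cpi.
have := hCv i; have := hgam i; have := hgammai i; nra.
Qed.

Lemma cgam_gt0 u : admissible u -> 0 < cgam gam (rho u) (pressure Cv gammai u).
Proof.
move=> hu; case: (hu) => _ r0 _; rewrite sqrtr_gt0 divr_gt0// mulr_gt0 ?pressure_gt0//.
exact: lt_trans gam_gt1.
Qed.

Lemma cgam_sqr u : admissible u ->
  cgam gam (rho u) (pressure Cv gammai u) ^+ 2 = gam * pressure Cv gammai u / rho u.
Proof.
move=> hu; case: (hu) => _ r0 _; rewrite sqr_sqrtr// ltW//.
rewrite divr_gt0// mulr_gt0 ?pressure_gt0//.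
exact: lt_trans gam_gt1.
Qed.

(* With sigma = s - mu v.n, twice the internal energy of s u - mu f(u).n times
   the squared density is 2 sigma^2 rho^2 e - mu^2 p^2. *)
Lemma admissible_minus_flux u (n : 'rV[R]_2) (s mu : R) :
  admissible u -> dotv n n = 1 -> 0 <= mu ->
  mu * (`|dotv (vel u) n| + cgam gam (rho u) (pressure Cv gammai u)) < s ->
  admissible (s *: u - mu *: flux Cv gammai u n).
Proof.
move=> hu n1 mu0 hs; have c0 := cgam_gt0 hu; have c2 := cgam_sqr hu.
have p0 := pressure_gt0 hu; have ple := pressure_le hu.
have /admissibleP[hm hsm r0 he] := hu; have [_ _ e0] := hu.
have eE := eintE (lt0r_neq0 r0).
set c := cgam _ _ _ in hs c0 c2 *; set pr := pressure _ _ _ in p0 ple c2 *.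
set vn := dotv (vel u) n in hs *.
pose sg := s - mu * vn.
have sgc : mu * c < sg.
  have : mu * vn <= mu * `|vn| by rewrite ler_wpM2l// ler_norm.
  by rewrite /sg; lra.
have sg0 : 0 < sg by apply: le_lt_trans sgc; rewrite mulr_ge0// ltW.
apply/admissibleP; set z := _ - _.
have mE i : partial_mass z 0 i = sg * partial_mass u 0 i.
  by rewrite !mxE /sg -/vn mulrBl mulrA.
have rE : rho z = sg * rho u.
  by rewrite /z /rho /= -/(rho u) -/vn /sg /GRing.scale /=; ring.
have momE : momentum z = sg *: momentum u - (mu * pr) *: n.
  rewrite /z /momentum /= -/(momentum u) -/vn -/pr /vel scalerDr opprD addrA; congr (_ - _).
    rewrite !scalerA /sg scalerBl; congr (_ - _ *: _).
    by field; rewrite gt_eqF.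
  by rewrite scalerA.
have EE : rhoE z = sg * rhoE u - mu * pr * vn.
  by rewrite /z /rhoE /= -/(rhoE u) -/vn -/pr /sg /GRing.scale /=; ring.
split.
- by move=> i; rewrite mE mulr_ge0// ltW.
- by under eq_bigr do rewrite mE; rewrite -mulr_sumr rE ler_pM2l.
- by rewrite rE mulr_gt0.
have mn : dotv (momentum u) n = rho u * vn.
  by rewrite /vn /vel dotvZl mulrA divff ?mul1r// gt_eqF.
rewrite rE EE momE -scaleNr dotvDl !dotvDr !dotvZl !dotvZr n1 (dotvC n) mn.
rewrite -subr_gt0; set D := dotv _ _ in eE *.
have DE : D = 2 * rho u * rhoE u - 2 * rho u ^+ 2 * eint u.
  by rewrite eE; field; rewrite gt_eqF.
have -> : 2 * (sg * rho u) * (sg * rhoE u - mu * pr * vn) -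
  (sg * (sg * D) + sg * (- (mu * pr) * (rho u * vn)) +
   (- (mu * pr) * (sg * (rho u * vn)) + - (mu * pr) * (- (mu * pr) * 1)))
  = 2 * sg ^+ 2 * rho u ^+ 2 * eint u - (mu * pr) ^+ 2 by rewrite DE; ring.
rewrite subr_gt0.
have re : 0 < rho u * eint u by exact: mulr_gt0.
(* As c^2 = gam p / rho, the middle term is 2 mu^2 p (gam rho e), and gam rho e dominates p by
   [pressure_le]. *)
apply: (@le_lt_trans _ _ ((mu * c) ^+ 2 * (2 * rho u ^+ 2 * eint u))).
  have -> : (mu * c) ^+ 2 * (2 * rho u ^+ 2 * eint u)
    = mu ^+ 2 * (pr * (2 * (gam * (rho u * eint u)))).
    by rewrite exprMn c2; field; rewrite gt_eqF.
  rewrite exprMn ler_wpM2l ?sqr_ge0// expr2 ler_wpM2l//; first exact: ltW.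
  by apply: le_trans ple _; have := gam_gt1; nra.
have -> : 2 * sg ^+ 2 * rho u ^+ 2 * eint u = sg ^+ 2 * (2 * rho u ^+ 2 * eint u) by ring.
rewrite ltr_pM2r; last by rewrite !mulr_gt0// exprn_gt0.
have mc0 : 0 <= mu * c by rewrite mulr_ge0// ltW.
by rewrite !expr2 ltr_pM.
Qed.

End GasTheory.

(** * The relaxation Riemann solver *)

Section LagrangianSpeeds.
Variable R : realType.

Lemma pospart_ge0 (x : R) : 0 <= pospart x.
Proof. by rewrite /pospart le_max lexx orbT. Qed.

Lemma pospart_ge (x : R) : x <= pospart x.
Proof. by rewrite /pospart le_max lexx. Qed.

(** With D = u_L - u_R, the last two bounds are the wave ordering S_L < u^star < S_R. The side of
    lower pressure comes first, its speed using [rR * cR] in place of the still unknown [aR]. Since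
    P >= 0 and [rR * cR <= aR], this can only enlarge the positive part. *)
Lemma lag_speeds_ineq (rL rR cL cR alpha D P aL aR : R) :
  0 < rL -> 0 < rR -> 0 < cL -> 0 < cR -> 1 <= alpha -> 0 <= P ->
  aL = rL * (cL + alpha * pospart (P / (rR * cR) + D)) ->
  aR = rR * (cR + alpha * pospart (- P / aL + D)) ->
  [/\ rL * cL <= aL, rR * cR <= aR,
      (aR * D + P) / (aL + aR) < aL / rL
    & (aL * D - P) / (aL + aR) < aR / rR].
Proof.
move=> rL0 rR0 cL0 cR0 al1 P0 eL eR.
set X := pospart (P / (rR * cR) + D) in eL.
set Y := pospart (- P / aL + D) in eR.
have X0 : 0 <= X := pospart_ge0 _; have Y0 : 0 <= Y := pospart_ge0 _.
have hL : rL * cL <= aL by rewrite eL ler_pM2l//; nra.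
have hR : rR * cR <= aR by rewrite eR ler_pM2l//; nra.
have rcL : 0 < rL * cL by exact: mulr_gt0.
have rcR : 0 < rR * cR by exact: mulr_gt0.
have aL0 := lt_le_trans rcL hL; have aR0 := lt_le_trans rcR hR.
have aLr : aL / rL = cL + alpha * X by rewrite eL; field; rewrite gt_eqF.
have aRr : aR / rR = cR + alpha * Y by rewrite eR; field; rewrite gt_eqF.
have s0 : 0 < aL + aR by exact: addr_gt0.
split=> //.
  have XD : P / aR + D <= X.
    apply: le_trans (pospart_ge _); rewrite lerD2r ler_wpM2l// lef_pV2 ?posrE//.
  rewrite aLr ltr_pdivrMr//.
  apply: (@le_lt_trans _ _ (aR * X)).
    have -> : aR * D + P = aR * (P / aR + D) by field; rewrite gt_eqF.
    by rewrite ler_pM2l.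
  have : X < cL + alpha * X by nra.
  move: (cL + alpha * X) => W; nra.
have YD : - P / aL + D <= Y by exact: pospart_ge.
rewrite aRr ltr_pdivrMr//.
apply: (@le_lt_trans _ _ (aL * Y)).
  have -> : aL * D - P = aL * (- P / aL + D) by field; rewrite gt_eqF.
  by rewrite ler_pM2l.
have : Y < cR + alpha * Y by nra.
move: (cR + alpha * Y) => W; nra.
Qed.

End LagrangianSpeeds.

Section Riemann.
Variables (R : realType) (m : nat) (Cv gammai : 'I_m.+1 -> R) (gam : R).
Hypotheses (hCv : forall i, 0 < Cv i) (hgammai : forall i, 1 < gammai i).
Hypothesis hgam : forall i, gammai i < gam.
Variable n : 'rV[R]_2.
Hypothesis n1 : dotv n n = 1.
Implicit Types u v : state R m.

Lemma state_eq u v : partial_mass u = partial_mass v -> rho u = rho v ->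
  momentum u = momentum v -> rhoE u = rhoE v -> u = v.
Proof.
by case: u v => [[[a b] c] d] [[[a' b'] c'] d'];
  rewrite /partial_mass /rho /momentum /rhoE /= => -> -> -> ->.
Qed.

Lemma flux_withE u (pr : R) : flux_with u pr n =
  dotv (vel u) n *: u + ((0, 0), pr *: n, pr * dotv (vel u) n).
Proof.
apply: state_eq.
- by apply/rowP => i; rewrite /partial_mass !mxE addr0.
- by rewrite /rho /= /GRing.scale /=; rewrite addr0 mulrC.
- rewrite /momentum /=; congr (_ + _).
  (* At zero density the inverse is 0 by convention, so [vel u] is 0 and both sides vanish. *)
  have [r0|r0] := eqVneq (rho u) 0.
    by rewrite r0 mul0r scale0r /vel r0 invr0 scale0r dotv0l scale0r.
  by rewrite /vel scalerA mulrAC divff// mul1r.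
- by rewrite /rhoE /= /GRing.scale /=; ring.
Qed.

(* The left intermediate state is obtained for [b = a_L] and the right one
   for [b = - a_R]. *)
Definition star u (b us ps : R) : state R m :=
  mkstate ((rho u)^-1 + (us - dotv (vel u) n) / b)^-1 (massfrac u)
    (vel u + (us - dotv (vel u) n) *: n)
    (Etot u - (ps * us - pressure Cv gammai u * dotv (vel u) n) / b).

Section Star.
Variables (u : state R m) (b us ps : R).
Hypotheses (hu : admissible u) (b0 : b != 0).
Let q := dotv (vel u) n.
Let c := cgam gam (rho u) (pressure Cv gammai u).
Hypothesis bc : (rho u * c) ^+ 2 <= b ^+ 2.
Hypothesis tau0 : 0 < (rho u)^-1 + (us - q) / b.
Hypothesis psE : ps = pressure Cv gammai u - b * (us - q).

Let d0 : 0 < rho (star u b us ps). Proof. by rewrite /rho /= invr_gt0. Qed.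

Lemma vel_star : vel (star u b us ps) = vel u + (us - q) *: n.
Proof. by rewrite /vel /momentum /= scalerA mulVf ?scale1r// gt_eqF. Qed.

Lemma vel_star_n : dotv (vel (star u b us ps)) n = us.
Proof. by rewrite vel_star dotvDl dotvZl n1 -/q; ring. Qed.

(** Completing the square, the new internal energy is (us - q - p / b)^2 / 2 + e - p^2 / (2 b^2).
    The subcharacteristic condition [bc] gives 2 e b^2 >= 2 p (gam rho e), which exceeds p^2 by
    [pressure_le]. *)
Lemma star_admissible : admissible (star u b us ps).
Proof.
have [hY r0 e0] := hu; have p0 := pressure_gt0 hCv hgammai hu.
have ple := pressure_le hCv hgammai hgam hu.
have c2 := cgam_sqr hCv hgammai hgam hu; rewrite -/c in c2.
split=> //.
  suff -> : massfrac (star u b us ps) = massfrac u by [].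
  by rewrite /massfrac /= scalerA mulVf ?scale1r// gt_eqF.
rewrite /eint vel_star /Etot.
have -> : rhoE (star u b us ps) / rho (star u b us ps) =
   Etot u - (ps * us - pressure Cv gammai u * q) / b.
  by rewrite /rhoE /= mulrAC divff ?mul1r// gt_eqF.
rewrite dotv_shift// -/q psE.
move: e0 ple; rewrite /eint -/(Etot u).
set D := dotv _ _; set E := Etot u; set pr := pressure _ _ _ in p0 c2 *.
set e := E - D / 2 => e0 ple.
have eD : E = e + D / 2 by rewrite /e; ring.
rewrite eD.
have -> : e + D / 2 - ((pr - b * (us - q)) * us - pr * q) / b -
  (D + 2 * (us - q) * q + (us - q) ^+ 2) / 2
  = (us - q - pr / b) ^+ 2 / 2 + (2 * e * b ^+ 2 - pr ^+ 2) / (2 * b ^+ 2).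
  by field.
have b2 : 0 < b ^+ 2 by rewrite exprn_even_gt0.
apply: ltr_wpDl; first by rewrite divr_ge0 ?sqr_ge0.
apply: divr_gt0; last exact: mulr_gt0.
rewrite subr_gt0.
apply: (@lt_le_trans _ _ (2 * e * (rho u * c) ^+ 2)); last first.
  by rewrite ler_wpM2l// mulr_ge0// ltW.
have -> : 2 * e * (rho u * c) ^+ 2 = 2 * pr * (gam * (rho u * e)).
  by rewrite exprMn c2; field; rewrite gt_eqF.
rewrite expr2; nra.
Qed.

(** Rankine-Hugoniot relation across the outer wave, whose speed S = q - b / rho also equals us
    minus b times the new specific volume. *)
Lemma star_jump : flux_with (star u b us ps) ps n =
  flux Cv gammai u n + (q - b / rho u) *: (star u b us ps - u).
Proof.
have [_ r0 _] := hu; have rn0 : rho u != 0 by rewrite gt_eqF.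
have tn0 := lt0r_neq0 tau0; move: tn0.
rewrite /flux !flux_withE vel_star_n -/q => tn0.
have SE : q - b / rho u = us - b * ((rho u)^-1 + (us - q) / b).
  by field; rewrite rn0 b0.
have pm : partial_mass u = rho u *: massfrac u by rewrite scalerA divff ?scale1r.
have mm : momentum u = rho u *: vel u by rewrite scalerA divff ?scale1r.
have EE : rhoE u = rho u * Etot u by rewrite mulrCA divff ?mulr1.
(* The mass flux through the wave is the same on both sides: d (us - S) = rho (q - S) = b. Here x is
   a quantity per unit mass and y its jump; all four components are instances. *)
have jump x y : us * (((rho u)^-1 + (us - q) / b)^-1 * (x + y)) - b * y =
    q * (rho u * x) + (q - b / rho u) *
      (((rho u)^-1 + (us - q) / b)^-1 * (x + y) - rho u * x).
  move: SE tn0; move: (_ + _ / _) => t SE tn0.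
  have -> : us = q - b / rho u + b * t by rewrite SE subrK.
  by field; rewrite rn0 tn0.
move: jump; set d : R := (_ + _)^-1; set S := q - b / rho u => jump.
apply: state_eq.
- change (us *: (d *: massfrac u) + 0 =
    q *: partial_mass u + 0 + S *: (d *: massfrac u - partial_mass u)).
  rewrite pm; apply/rowP => i; rewrite ![fun_of_matrix (_ + _) _ _]mxE.
  have := jump (massfrac u 0 i) 0; move: (massfrac u) => Y.
  by rewrite !mxE !addr0 mulr0 subr0.
- change (us * d + 0 = q * rho u + 0 + S * (d - rho u)).
  by have := jump 1 0; rewrite !addr0 mulr0 subr0 !mulr1.
- change (us *: (d *: (vel u + (us - q) *: n)) + ps *: n =
    q *: momentum u + pressure Cv gammai u *: n +
    S *: (d *: (vel u + (us - q) *: n) - momentum u)).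
  rewrite mm; apply/rowP => i; have := jump (vel u 0 i) ((us - q) * n 0 i).
  move: (vel u) => V; rewrite !mxE psE.
  move: (n 0 i) (V 0 i) (pressure _ _ _) => ni Vi pr; lra.
- change (us * (d * (Etot u - (ps * us - pressure Cv gammai u * q) / b)) + ps * us =
    q * rhoE u + pressure Cv gammai u * q +
    S * (d * (Etot u - (ps * us - pressure Cv gammai u * q) / b) - rhoE u)).
  have := jump (Etot u) (- (ps * us - pressure Cv gammai u * q) / b).
  set x := ps * us - _; rewrite (_ : b * (- x / b) = - x); last by field.
  rewrite opprK mulNr EE /x; move: (x / b) (rho u) (Etot u) => y r E; lra.
Qed.
End Star.

Variables uL uR : state R m.
Hypotheses (hL : admissible uL) (hR : admissible uR).
Let aL := (lag_speeds Cv gammai gam uL uR n).1.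
Let aR := (lag_speeds Cv gammai gam uL uR n).2.
Let us := ustar Cv gammai gam uL uR n.
Let ps := pstar Cv gammai gam uL uR n.
Let sL := SL Cv gammai gam uL uR n.
Let sR := SR Cv gammai gam uL uR n.
Let pL := pressure Cv gammai uL.
Let pR := pressure Cv gammai uR.
Let qL := dotv (vel uL) n.
Let qR := dotv (vel uR) n.
Let cL := cgam gam (rho uL) pL.
Let cR := cgam gam (rho uR) pR.

Lemma lag_speeds_bounds : [/\ rho uL * cL <= aL, rho uR * cR <= aR,
   sL < us & us < sR].
Proof.
have [_ rL0 _] := hL; have [_ rR0 _] := hR.
have cL0 := cgam_gt0 hCv hgammai hgam hL; have cR0 := cgam_gt0 hCv hgammai hgam hR.
rewrite -/pL -/cL in cL0; rewrite -/pR -/cR in cR0.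
have al1 : 1 <= (gam + 1) / 2 by have := gam_gt1 hgammai hgam; lra.
pose D := qL - qR.
suff [h1 h2 h3 h4] : [/\ rho uL * cL <= aL, rho uR * cR <= aR,
    (aR * D + (pR - pL)) / (aL + aR) < aL / rho uL
  & (aL * D - (pR - pL)) / (aL + aR) < aR / rho uR].
  have a0 : 0 < aL + aR.
    by rewrite addr_gt0// (lt_le_trans _ h1, lt_le_trans _ h2) ?mulr_gt0.
  have us1 : us = qL - (aR * D + (pR - pL)) / (aL + aR).
    by rewrite /us /ustar -/aL -/aR -/qL -/qR -/pL -/pR /D; field; rewrite gt_eqF.
  have us2 : us = qR + (aL * D - (pR - pL)) / (aL + aR).
    by rewrite /us /ustar -/aL -/aR -/qL -/qR -/pL -/pR /D; field; rewrite gt_eqF.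
  split=> //; first by rewrite us1 /sL /SL -/aL -/qL ltrD2l ltrN2.
  by rewrite us2 /sR /SR -/aR -/qR ltrD2l.
have eA (x : R) : x + qL - qR = x + D by rewrite /D addrA.
rewrite /aL /aR /lag_speeds -/pL -/pR -/qL -/qR -/cL -/cR !eA.
case: (leP pL pR) => hp /=.
  have P0 : 0 <= pR - pL by rewrite subr_ge0.
  apply: (@lag_speeds_ineq _ (rho uL) (rho uR) cL cR ((gam + 1) / 2)) => //.
  by rewrite opprB.
have P0 : 0 <= pL - pR by rewrite subr_ge0 ltW.
(* Mirror case: the right side now has the lower pressure, so left and right exchange roles while D
   is kept. *)
set bR := rho uR * _; set bL := rho uL * (cL + _).
have [] := @lag_speeds_ineq _ (rho uR) (rho uL) cR cL ((gam + 1) / 2) D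
  (pL - pR) bR bL rR0 rL0 cR0 cL0 al1 P0.
- by [].
- by rewrite opprB.
rewrite (addrC bR) => h1 h2 h3 h4.
by rewrite -[pR - pL]opprB opprK.
Qed.

Let rL0 : 0 < rho uL. Proof. by case: hL. Qed.
Let rR0 : 0 < rho uR. Proof. by case: hR. Qed.
Let cL0 : 0 < rho uL * cL. Proof. by rewrite mulr_gt0// (cgam_gt0 hCv hgammai hgam). Qed.
Let cR0 : 0 < rho uR * cR. Proof. by rewrite mulr_gt0// (cgam_gt0 hCv hgammai hgam). Qed.
Let aL0 : 0 < aL. Proof. by case: lag_speeds_bounds => h _ _ _; exact: lt_le_trans h. Qed.
Let aR0 : 0 < aR. Proof. by case: lag_speeds_bounds => _ h _ _; exact: lt_le_trans h. Qed.

Let ustarLE : ustarL Cv gammai gam uL uR n = star uL aL us ps.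
Proof. by []. Qed.

Let ustarRE : ustarR Cv gammai gam uL uR n = star uR (- aR) us ps.
Proof.
rewrite /ustarR /star -/aR -/us -/ps; congr (mkstate (_ + _)^-1 _ _ (_ - _)).
  by rewrite invrN mulrN -mulNr opprB.
by rewrite invrN mulrN -mulNr opprB.
Qed.

Let psL : ps = pL - aL * (us - qL).
Proof.
rewrite /ps /us /pstar /ustar -/aL -/aR -/pL -/pR -/qL -/qR.
by field; rewrite gt_eqF// addr_gt0.
Qed.

Let psR : ps = pR - (- aR) * (us - qR).
Proof.
rewrite /ps /us /pstar /ustar -/aL -/aR -/pL -/pR -/qL -/qR.
by field; rewrite gt_eqF// addr_gt0.
Qed.

(** The intermediate specific volume is (us - S_L) / a_L, so its positivity is the wave ordering. *)
Let tauL : 0 < (rho uL)^-1 + (us - qL) / aL.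
Proof.
have -> : (rho uL)^-1 + (us - qL) / aL = (us - (qL - aL / rho uL)) / aL.
  by field; rewrite !gt_eqF.
by rewrite divr_gt0// subr_gt0; case: lag_speeds_bounds.
Qed.

Let tauR : 0 < (rho uR)^-1 + (us - qR) / (- aR).
Proof.
have -> : (rho uR)^-1 + (us - qR) / (- aR) = (qR + aR / rho uR - us) / aR.
  by field; rewrite !gt_eqF.
by rewrite divr_gt0// subr_gt0; case: lag_speeds_bounds.
Qed.

Let bcL : (rho uL * cL) ^+ 2 <= aL ^+ 2.
Proof. by have [h _ _ _] := lag_speeds_bounds; rewrite !expr2 ler_pM// ltW. Qed.

Let bcR : (rho uR * cR) ^+ 2 <= (- aR) ^+ 2.
Proof. by have [_ h _ _] := lag_speeds_bounds; rewrite sqrrN !expr2 ler_pM// ltW. Qed.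

Let aLn : aL != 0. Proof. by rewrite gt_eqF. Qed.
Let aRn : - aR != 0. Proof. by rewrite oppr_eq0 gt_eqF. Qed.

Let zL := star uL aL us ps.
Let zR := star uR (- aR) us ps.
Let zLa : admissible zL. Proof. exact: star_admissible bcL tauL psL. Qed.
Let zRa : admissible zR. Proof. exact: star_admissible bcR tauR psR. Qed.

Let jumpL : flux_with zL ps n = flux Cv gammai uL n + sL *: (zL - uL).
Proof. exact: star_jump. Qed.

Let jumpR : flux_with zR ps n = flux Cv gammai uR n + sR *: (zR - uR).
Proof.
rewrite star_jump//; congr (_ + _ *: _).
by rewrite /sR /SR mulNr opprK.
Qed.

(** The intermediate states share the normal velocity [us] and the pressure [ps], so the middle wave
    is a pure contact. *)
Let jumpC : flux_with zR ps n = flux_with zL ps n + us *: (zR - zL).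
Proof.
by rewrite !flux_withE !vel_star_n// scalerBr [RHS]addrC addrA subrK.
Qed.

(** Summation by parts over the waves. For mu >= 0 the weights of [z1], [z2] and [v] are nonnegative
    once a <= b <= c <= 0. *)
Lemma upwind_split (u f z1 z2 v : state R m) (mu a b c : R) :
  u - mu *: (f + a *: (z1 - u) + b *: (z2 - z1) + c *: (v - z2)) =
  ((1 + mu * a) *: u - mu *: f) + (mu * (b - a)) *: z1 + (mu * (c - b)) *: z2
  + (mu * - c) *: v.
Proof.
apply: state_eq.
- by apply/rowP => i; rewrite /partial_mass /= !mxE; ring.
- by rewrite /rho /= /GRing.scale /=; ring.
- by apply/rowP => i; rewrite /momentum /= !mxE; ring.
- by rewrite /rhoE /= /GRing.scale /=; ring.
Qed.

Lemma admissible_minus_hflux (mu : R) : 0 <= mu ->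
  2 * (mu * wave_speedL Cv gammai gam uL uR n) < 1 ->
  admissible (uL - mu *: hflux Cv gammai gam uL uR n).
Proof.
move=> mu0; rewrite /wave_speedL -/aL -/qL => cfl.
have [caL _ LU UR] := lag_speeds_bounds.
have cq : cL <= aL / rho uL by rewrite ler_pdivlMr// mulrC.
(* The witnesses are S_L, [us] and S_R capped at 0: only waves moving into the left state contribute
   to the flux. *)
suff [a [b [c [[a1 ab bc c0] hE]]]] : exists a b c,
   [/\ - (`|qL| + aL / rho uL) <= a, a <= b, b <= c & c <= 0] /\
   hflux Cv gammai gam uL uR n =
   flux Cv gammai uL n + a *: (zL - uL) + b *: (zR - zL) + c *: (uR - zR).
  rewrite hE upwind_split; apply: admissibleDl; last first.
    by apply: admissible0Z; [rewrite mulr_ge0// oppr_ge0|right].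
  apply: admissibleDl; last first.
    by apply: admissible0Z; [rewrite mulr_ge0// subr_ge0|right].
  apply: admissibleDl; last first.
    by apply: admissible0Z; [rewrite mulr_ge0// subr_ge0|right].
  apply: (admissible_minus_flux hCv hgammai hgam) => //; rewrite -/qL -/pL -/cL.
  (* The factor 2 in the CFL hypothesis splits: one half absorbs - mu a, the other bounds mu (|v.n|
     + c). *)
  have h1 : mu * - (`|qL| + aL / rho uL) <= mu * a by rewrite ler_wpM2l.
  have h2 : mu * (`|qL| + cL) <= mu * (`|qL| + aL / rho uL).
    by rewrite ler_wpM2l// lerD2l.
  by move: h1 h2 cfl; rewrite mulrN; lra.
have nL : - (`|qL| + aL / rho uL) <= sL.
  by rewrite /sL /SL -/aL -/qL; have := ler_norm (- qL); rewrite normrN; lra.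
have wL : 0 <= `|qL| + aL / rho uL by rewrite addr_ge0// divr_ge0// ltW.
rewrite /hflux /riemann ustarLE ustarRE -/us -/ps -/sL -/sR -/zL -/zR.
have fR : flux Cv gammai uR n = flux_with zR ps n + sR *: (uR - zR).
  by rewrite jumpR -addrA -scalerDr addrA subrK subrr scaler0 addr0.
case: ltP => [s0|s0].
  exists 0, 0, 0; rewrite lexx oppr_le0 wL; split=> //.
  by rewrite !scale0r !addr0.
case: ltP => [u0|u0].
  exists sL, 0, 0; rewrite lexx nL s0; split=> //.
  by rewrite !scale0r !addr0 jumpL.
case: ltP => [t0|t0].
  exists sL, us, 0; rewrite nL u0 (ltW LU); split=> //.
  by rewrite scale0r addr0 /= jumpC jumpL.
exists sL, us, sR; rewrite nL t0 (ltW LU) (ltW UR); split=> //.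
by rewrite -/(flux Cv gammai uR n) fR jumpC jumpL.
Qed.

End Riemann.

(** * Bilinear quadrilaterals *)

Section Geometry.
Variable R : realType.

Lemma ord2P (i : 'I_2) : i = 0 \/ i = 1.
Proof. by case: i => -[|[|//]] hi; [left|right]; apply: val_inj. Qed.

Lemma sum_ord2 (V : zmodType) (F : 'I_2 -> V) : \sum_i F i = F 0 + F 1.
Proof.
by rewrite !big_ord_recl big_ord0 addr0; congr (_ + F _); apply: val_inj.
Qed.

Lemma det_mx2 (A : 'M[R]_2) : \det A = A 0 0 * A 1 1 - A 0 1 * A 1 0.
Proof.
rewrite (expand_det_row _ 0) sum_ord2 /cofactor !det_mx11 !mxE.
have -> : lift 0 0 = 1 :> 'I_2 by apply: val_inj.
have -> : lift 1 0 = 0 :> 'I_2 by apply: val_inj.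
by rewrite /= expr0 expr1; ring.
Qed.

Lemma det_invmx2 (A : 'M[R]_2) : \det A != 0 ->
  \det A *: invmx A = \matrix_(i, j) (if i == 0
    then (if j == 0 then A 1 1 else - A 0 1)
    else (if j == 0 then - A 1 0 else A 0 0)).
Proof.
move=> d0; set B := matrix_of_fun _ _.
have uA : A \in unitmx by rewrite unitmxE unitfE.
have BA : B *m A = (\det A)%:M.
  apply/matrixP => i j; rewrite !mxE sum_ord2 !mxE det_mx2.
  by case: (ord2P i) (ord2P j) => -> [] -> /=; rewrite ?mulr1n ?mulr0n; ring.
by rewrite -[B in RHS](mulmxK uA) BA mul_scalar_mx.
Qed.

Lemma enorm_gt0 (a : 'rV[R]_2) : (0 < enorm a) = (a != 0).
Proof.
rewrite sqrtr_gt0 lt_neqAle dotv_ge0 andbT eq_sym; congr (~~ _).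
apply/eqP/eqP => [|->]; last exact: dotv0l.
rewrite dotvE -!expr2 => /eqP; rewrite paddr_eq0 ?sqr_ge0// !sqrf_eq0.
by move=> /andP[/eqP h0 /eqP h1]; apply/rowP => i; rewrite mxE; case: (ord2P i) => ->.
Qed.

Lemma enorm_ge0 (a : 'rV[R]_2) : 0 <= enorm a.
Proof. exact: sqrtr_ge0. Qed.

Lemma rotcwZ (x : R) a : rotcw (x *: a) = x *: rotcw a.
Proof. by apply/rowP => i; rewrite !mxE; case: ifP => _; rewrite ?mxE ?mulrN. Qed.

Lemma rotcwD (a b : 'rV[R]_2) : rotcw (a + b) = rotcw a + rotcw b.
Proof. by apply/rowP => i; rewrite !mxE; case: ifP => _; rewrite ?mxE ?opprD. Qed.

Lemma derive1_affine (a b s : R) : derive1 (fun z => a + b * z) s = b.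
Proof.
rewrite derive1E; have -> : (fun z => a + b * z) = cst a + (b \*: (@id R)).
  by [].
by rewrite deriveD// derive_cst deriveZ// derive_id add0r scaler1.
Qed.

Variable Q : quad R.

(** Tangent vector of [qmap] along xi. The map is bilinear, so it depends on eta only, and
    affinely. *)
Definition dxi (t : R) : 'rV[R]_2 :=
  2^-1 *: \sum_(b : bool) hat b t *: (Q true b - Q false b).
Definition deta (s : R) : 'rV[R]_2 :=
  2^-1 *: \sum_(a : bool) hat a s *: (Q a true - Q a false).

Lemma jacmxE s t i j : jacmx Q s t i j = if j == 0 then dxi t 0 i else deta s 0 i.
Proof.
rewrite mxE; case: ifP => _.
  rewrite (_ : (fun z => _) = (fun z => (hat true t * (Q true true 0 i + Q false true 0 i)
    + hat false t * (Q true false 0 i + Q false false 0 i)) / 2 + dxi t 0 i * z)).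
    exact: derive1_affine.
  by apply/funext => z; rewrite /qmap /dxi !big_bool !mxE /hat; field.
rewrite (_ : (fun z => _) = (fun z => (hat true s * (Q true true 0 i + Q true false 0 i)
    + hat false s * (Q false true 0 i + Q false false 0 i)) / 2 + deta s 0 i * z)).
  exact: derive1_affine.
by apply/funext => z; rewrite /qmap /deta !big_bool !mxE /hat; field.
Qed.

Lemma JdetE s t : Jdet Q s t = cross (dxi t) (deta s).
Proof. by rewrite /Jdet det_mx2 !jacmxE /cross /=; ring. Qed.

(** J times the inverse Jacobian matrix is its adjugate, so J grad xi is a rotated tangent vector,
    constant along each line xi = const and in particular along a side. *)
Lemma Jgrad_xiE s t : 0 < Jdet Q s t -> Jgrad_xi Q s t = rotcw (deta s).
Proof.
move=> J0; rewrite /Jgrad_xi -linearZ det_invmx2 ?gt_eqF//.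
by rewrite !jacmxE; apply/rowP => j; case: (ord2P j) => ->; rewrite !mxE.
Qed.

Lemma Jgrad_etaE s t : 0 < Jdet Q s t -> Jgrad_eta Q s t = - rotcw (dxi t).
Proof.
move=> J0; rewrite /Jgrad_eta -linearZ det_invmx2 ?gt_eqF//.
by rewrite !jacmxE; apply/rowP => j; case: (ord2P j) => ->; rewrite !mxE ?opprK.
Qed.

Lemma dxi_end : dxi 1 = - (2^-1 *: (side_end Q North - side_start Q North)).
Proof. by rewrite /dxi big_bool; apply/rowP => i; rewrite !mxE /hat /=; field. Qed.
Lemma dxi_start : dxi (-1) = 2^-1 *: (side_end Q South - side_start Q South).
Proof. by rewrite /dxi big_bool; apply/rowP => i; rewrite !mxE /hat /=; field. Qed.
Lemma deta_end : deta 1 = 2^-1 *: (side_end Q East - side_start Q East).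
Proof. by rewrite /deta big_bool; apply/rowP => i; rewrite !mxE /hat /=; field. Qed.
Lemma deta_start : deta (-1) = - (2^-1 *: (side_end Q West - side_start Q West)).
Proof. by rewrite /deta big_bool; apply/rowP => i; rewrite !mxE /hat /=; field. Qed.

Lemma dxi_affine t : dxi t = dxi 0 + t *: (4^-1 *:
  (Q true true - Q false true - Q true false + Q false false)).
Proof. by rewrite /dxi !big_bool; apply/rowP => i; rewrite !mxE /hat /=; field. Qed.
Lemma deta_affine s : deta s = deta 0 + s *: (4^-1 *:
  (Q true true - Q false true - Q true false + Q false false)).
Proof. by rewrite /deta !big_bool; apply/rowP => i; rewrite !mxE /hat /=; field. Qed.

Hypothesis hJ : forall s t, -1 <= s <= 1 -> -1 <= t <= 1 -> 0 < Jdet Q s t.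

(** The corners (1, 1) and (-1, -1) together meet all four sides. A degenerate side would give a
    zero tangent vector at one of them, and the Jacobian would vanish there. *)
Lemma side_len_gt0 e : 0 < side_len Q e.
Proof.
rewrite enorm_gt0; apply/eqP => h.
have i1 : -1 <= (1 : R) <= 1 by rewrite lexx andbT; lra.
have i2 : -1 <= (-1 : R) <= 1 by rewrite lexx; lra.
have := hJ i1 i1; have := hJ i2 i2; rewrite !JdetE.
rewrite dxi_end dxi_start deta_end deta_start.
by case: e h => ->; rewrite scaler0 ?oppr0 /cross !mxE !(mulr0, mul0r) subrr ltxx.
Qed.

Lemma side_normal_unit e : dotv (side_normal Q e) (side_normal Q e) = 1.
Proof.
have l0 := side_len_gt0 e; rewrite /side_normal dotvZl dotvZr.
set a := side_end Q e - _.
have -> : dotv (rotcw a) (rotcw a) = dotv a a by rewrite !dotvE !mxE /=; ring.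
have <- : side_len Q e ^+ 2 = dotv a a by rewrite sqr_sqrtr// dotv_ge0.
by field; rewrite gt_eqF.
Qed.

Lemma side_normalE e : (side_len Q e / 2) *: side_normal Q e =
  rotcw (2^-1 *: (side_end Q e - side_start Q e)).
Proof.
rewrite rotcwZ scalerA mulrAC divff ?mul1r// gt_eqF//; exact: side_len_gt0.
Qed.

End Geometry.

(** * The volume flux *)

Section VolumeFluxTheory.
Variables (R : realType) (m : nat) (Cv gammai : 'I_m.+1 -> R).
Hypotheses (hCv : forall i, 0 < Cv i) (hgammai : forall i, 1 < gammai i).
Implicit Types (u v : state R m) (n : 'rV[R]_2).

Lemma logmeanC (a b : R) : logmean a b = logmean b a.
Proof.
rewrite /logmean eq_sym; case: eqP => [->//|_].
by rewrite -[b - a]opprB -[ln b - ln a]opprB invrN mulrNN.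
Qed.

Lemma logmeanxx (a : R) : logmean a a = a.
Proof. by rewrite /logmean eqxx. Qed.

Lemma avgC (V : lmodType R) (a b : V) : avg a b = avg b a.
Proof. by rewrite /avg addrC. Qed.

Lemma avgxx (V : lmodType R) (a : V) : avg a a = a.
Proof.
by rewrite /avg -[a + a]mulr2n -[a *+ 2]scaler_nat scalerA mulVf ?scale1r// pnatr_eq0.
Qed.

Lemma avgrC (a b : R) : avgr a b = avgr b a.
Proof. by rewrite /avgr addrC. Qed.

Lemma avgrxx (a : R) : avgr a a = a.
Proof. by rewrite /avgr; field. Qed.

Lemma hecC u v n : hec Cv gammai u v n = hec Cv gammai v u n.
Proof.
rewrite /hec /hec_E /hec_mom /hec_rhoY /hec_rho /hec_ratio.
rewrite (avgC (massfrac u)) (avgC (vel u)) (logmeanC (rho u)).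
rewrite (logmeanC (partial_density _ _ _ u)) (logmeanC (theta _ u)).
by rewrite (avgrC (theta _ u)) (avgrC (_ * theta _ u)) (dotvC (vel u)).
Qed.

Lemma theta_gt0 u : admissible u -> 0 < theta Cv u.
Proof.
move=> hu; rewrite invr_gt0 divr_gt0//; first by case: hu.
exact: mixCv_gt0.
Qed.

Lemma hec_consistent u n : admissible u -> hec Cv gammai u u n = flux Cv gammai u n.
Proof.
move=> hu; have [_ r0 e0] := hu; have th0 := theta_gt0 hu.
have C0 := mixCv_gt0 hCv hu.
have pE : avgr (pressure Cv gammai u * theta Cv u) (pressure Cv gammai u * theta Cv u)
   / avgr (theta Cv u) (theta Cv u) = pressure Cv gammai u.
  by rewrite !avgrxx mulfK// gt_eqF.
(* For equal states the quotient r_nc (rho r / r_nc - rho) / (r - r_nc) simplifies to rho, the value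
   of the degenerate branch as well. *)
have rhoYE : hec_ratio Cv gammai u u = rho u.
  rewrite /hec_ratio avgxx !logmeanxx /partial_density; case: eqP => // /eqP h.
  rewrite -subr_eq0 in h; have := ri_gt0 hCv hgammai ord_max.
  move: (ri _ _ _) h => r h r1; field; by rewrite h gt_eqF.
have pm i : partial_mass u 0 i = rho u * massfrac u 0 i.
  by rewrite mxE mulrA divff ?mul1r// gt_eqF.
have mm : momentum u = rho u *: vel u by rewrite scalerA divff ?scale1r// gt_eqF.
have hY : hec_rhoY Cv gammai u u n = dotv (vel u) n *: partial_mass u.
  by apply/rowP => i; rewrite mxE rhoYE !avgxx !mxE pm mxE; field; rewrite gt_eqF.
have hr : hec_rho u u n = rho u * dotv (vel u) n by rewrite /hec_rho logmeanxx avgxx.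
rewrite /hec /flux /flux_with hY hr /hec_mom hr pE avgxx; congr (_, _).
rewrite /hec_E hY hr pE avgxx logmeanxx.
(* The last mass fraction is 1 minus the others, so the weighted differences of heat capacities add
   up to C_v(Y) - C_v of the last component. Then e = C_v(Y) / theta gives the energy flux. *)
have sY : \sum_(i < m) (Cv (lift ord_max i) - Cv ord_max) / theta Cv u *
    (dotv (vel u) n *: partial_mass u) 0 i
  = (mixCv Cv (massfrac u) - Cv ord_max) / theta Cv u * (rho u * dotv (vel u) n).
  rewrite /mixCv /mix (bigD1_ord ord_max)//= /fullY unlift_none.
  under [in RHS]eq_bigr do rewrite liftK.
  set S := \sum_(i < m) massfrac u 0 i * _.
  have -> : (1 - \sum_(j < m) massfrac u 0 j) * Cv ord_max + S - Cv ord_max =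
    \sum_(i < m) massfrac u 0 i * (Cv (lift ord_max i) - Cv ord_max).
    under [RHS]eq_bigr do rewrite mulrBr.
    by rewrite sumrB -mulr_suml -/S; ring.
  rewrite -mulrA mulr_suml; apply: eq_bigr => i _; rewrite mxE pm; ring.
rewrite sY.
have thE : (theta Cv u)^-1 = eint u / mixCv Cv (massfrac u) by rewrite invrK.
have -> : (mixCv Cv (massfrac u) - Cv ord_max) / theta Cv u * (rho u * dotv (vel u) n)
 + (Cv ord_max / theta Cv u + dotv (vel u) (vel u) / 2) * (rho u * dotv (vel u) n)
 = (eint u + dotv (vel u) (vel u) / 2) * rho u * dotv (vel u) n.
  by rewrite thE; field; rewrite gt_eqF.
by rewrite /eint subrK /Etot divfK ?gt_eqF// -mulrDl.
Qed.

Lemma fluxZ u (c : R) n : flux Cv gammai u (c *: n) = c *: flux Cv gammai u n.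
Proof.
rewrite /flux /flux_with dotvZr; apply: state_eq.
- by rewrite /partial_mass /= scalerA.
- by rewrite /rho /= /GRing.scale /=; ring.
- rewrite /momentum /= scalerDr !scalerA; congr (_ *: _ + _ *: _); ring.
- by rewrite /rhoE /= /GRing.scale /=; ring.
Qed.

Definition pressure_flux (pr : R) n : state R m := ((0, 0), pr *: n, 0).

Lemma flux_rest u (pr : R) n : vel u = 0 -> pressure Cv gammai u = pr ->
  flux Cv gammai u n = pressure_flux pr n.
Proof.
move=> v0 <-; rewrite /flux /flux_with v0 dotv0l !scale0r !mulr0 scale0r.
by rewrite add0r.
Qed.

(** Zero mean velocity leaves only the pressure term, and a common pressure factors out of the theta
    averages whatever the temperature jump. *)
Lemma hec_rest u v (pr : R) n : admissible u -> admissible v ->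
  vel u = 0 -> vel v = 0 -> pressure Cv gammai u = pr -> pressure Cv gammai v = pr ->
  hec Cv gammai u v n = pressure_flux pr n.
Proof.
move=> hu hv vu vv pu pv.
have th0 : 0 < theta Cv u + theta Cv v by rewrite addr_gt0// theta_gt0.
have b0 : avg (vel u) (vel v) = 0 by rewrite vu vv avgxx.
have hY : hec_rhoY Cv gammai u v n = 0.
  by apply/rowP => i; rewrite mxE b0 dotv0l mulr0 mxE.
have hr : hec_rho u v n = 0 by rewrite /hec_rho b0 dotv0l mulr0.
rewrite /hec hY hr /hec_mom /hec_E hr b0 dotv0l hY.
congr (_, _, _, _).
  rewrite scale0r add0r pu pv; congr (_ *: _).
  by rewrite /avgr; field; rewrite gt_eqF.
by rewrite big1 ?mulr0 ?addr0// => i _; rewrite mxE mulr0.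
Qed.

Variable gam : R.
Hypothesis hgam : forall i, gammai i < gam.

Lemma hflux_rest u v (pr : R) n : admissible u -> admissible v ->
  vel u = 0 -> vel v = 0 -> pressure Cv gammai u = pr -> pressure Cv gammai v = pr ->
  dotv n n = 1 -> hflux Cv gammai gam u v n = pressure_flux pr n.
Proof.
move=> hu hv vu vv pu pv n1.
have [_ r0 _] := hu; have [_ s0 _] := hv.
have cu := cgam_gt0 hCv hgammai hgam hu; have cv := cgam_gt0 hCv hgammai hgam hv.
have [hL hR _ _] := lag_speeds_bounds hCv hgammai hgam n hu hv.
set a := lag_speeds Cv gammai gam u v n in hL hR.
have a1 : 0 < a.1 by apply: lt_le_trans hL; rewrite mulr_gt0.
have a2 : 0 < a.2 by apply: lt_le_trans hR; rewrite mulr_gt0.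
have us0 : ustar Cv gammai gam u v n = 0.
  by rewrite /ustar -/a pu pv vu vv dotv0l !mulr0 addr0 add0r subrr mul0r.
have ps0 : pstar Cv gammai gam u v n = pr.
  rewrite /pstar -/a pu pv vu vv dotv0l subrr mulr0 addr0; field.
  by rewrite gt_eqF// addr_gt0.
(* The point x/t = 0 is the contact itself. The strict test against [ustar] fails, so the right
   intermediate state is selected, at rest and with pressure [pr]. *)
rewrite /hflux /riemann us0 ltxx.
have -> : 0 < SL Cv gammai gam u v n = false.
  by rewrite /SL -/a vu dotv0l sub0r oppr_gt0 ltNge divr_ge0// ltW.
have -> : 0 < SR Cv gammai gam u v n.
  by rewrite /SR -/a vv dotv0l add0r divr_gt0.
rewrite /= ps0 /flux_with.
have -> : vel (ustarR Cv gammai gam u v n) = 0.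
  by rewrite /vel /momentum /= us0 vv dotv0l subrr scale0r addr0 !scaler0.
by rewrite dotv0l !scale0r !mulr0 scaler0 add0r.
Qed.

End VolumeFluxTheory.

(** * Discrete differentiation of symmetric two-point fluxes *)

Section SummationByParts.
Variables (R : realType) (p : nat).
Hypothesis hp : (1 <= p)%N.
Variables xi w : 'I_p.+1 -> R.
Hypothesis hGL : gauss_lobatto xi w.

(** Symmetry of H allows one of the two copies of w_i D_il to be replaced with w_l D_li; [sbp] then
    leaves only the diagonal endpoint values. *)
Lemma sbp_sum (V : lmodType R) (H : 'I_p.+1 -> 'I_p.+1 -> V) :
  (forall i l, H i l = H l i) ->
  \sum_i \sum_l (2 * w i * Dmat xi i l) *: H i l = H ord_max ord_max - H ord0 ord0.
Proof.
move=> Hs.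
transitivity (\sum_i \sum_l (w i * Dmat xi i l) *: H i l +
              \sum_i \sum_l (w l * Dmat xi l i) *: H i l).
  rewrite [X in _ + X]exchange_big /= -big_split /=; apply: eq_bigr => i _.
  rewrite -big_split /=; apply: eq_bigr => l _.
  by rewrite (Hs l) -scalerDl; congr (_ *: _); ring.
rewrite -big_split /=.
transitivity (\sum_i \sum_l (((i == ord_max) && (l == ord_max))%:R
   - ((i == ord0) && (l == ord0))%:R) *: H i l).
  apply: eq_bigr => i _; rewrite -big_split /=; apply: eq_bigr => l _.
  by rewrite -scalerDl (sbp hp hGL).
have pick a : \sum_i \sum_l ((i == a) && (l == a))%:R *: H i l = H a a.
  rewrite (bigD1 a)//= [X in _ + X]big1 ?addr0 => [|i ia]; last first.
    by rewrite big1// => l _; rewrite (negPf ia) scale0r.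
  rewrite (bigD1 a)//= !eqxx scale1r big1 ?addr0// => l la.
  by rewrite (negPf la) andbF scale0r.
rewrite -(pick ord_max) -(pick ord0) -sumrB; apply: eq_bigr => i _.
by rewrite -sumrB; apply: eq_bigr => l _; rewrite scalerBl.
Qed.

(** D annihilates constants and differentiates X exactly. Only the half of the average taken at the
    moving node contributes, whence the factor 1/2. *)
Lemma Dmat_avg_affine (V : lmodType R) (a b : V) (i : 'I_p.+1) :
  \sum_l Dmat xi i l *: avg (a + xi i *: b) (a + xi l *: b) = 2^-1 *: b.
Proof.
have D0 : \sum_l Dmat xi i l = 0.
  have := @Dmat_exact _ _ hp _ _ hGL 1 i; rewrite size_poly1 => /(_ isT).
  rewrite -[1]/(1%:P) derivC horner0 => e; rewrite -[RHS]e.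
  by apply: eq_bigr => l _; rewrite hornerC mulr1.
have D1 : \sum_l Dmat xi i l * xi l = 1.
  have := @Dmat_exact _ _ hp _ _ hGL 'X i; rewrite size_polyX ltnS => /(_ hp).
  rewrite derivX hornerC => <-.
  by apply: eq_bigr => l _; rewrite hornerX.
transitivity (\sum_l (Dmat xi i l *: (a + 2^-1 *: (xi i *: b)) +
   (Dmat xi i l * xi l) *: (2^-1 *: b))).
  apply: eq_bigr => l _; rewrite /avg.
  have -> : a + xi i *: b + (a + xi l *: b) = 2 *: a + (xi i *: b + xi l *: b).
    by rewrite addrACA -mulr2n scaler_nat.
  rewrite scalerDr scalerA mulVf ?pnatr_eq0// scale1r !scalerDr addrA.
  by rewrite !scalerA; congr (_ + _ + _ *: _); ring.
rewrite big_split /= -!scaler_suml D0 D1 scale0r add0r scale1r.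
by [].
Qed.

End SummationByParts.

(** * Sums over the nodes of a cell *)

Section BoundarySums.
Variables (R : realType) (p : nat).

Lemma big_side (V : zmodType) (F : side -> V) :
  \sum_e F e = F South + F East + F North + F West.
Proof.
have bij : bijective side_decode.
  by exists side_code => [[[] []]|[]].
rewrite (reindex side_decode) /=; last exact: onW_bij.
transitivity (\sum_(c : bool * bool) F (side_decode (c.1, c.2))).
  by apply: eq_bigr => -[].
rewrite -(pair_bigA _ (fun a b => F (side_decode (a, b)))) /= !big_bool /=.
by rewrite [RHS]addrC [F South + F East + _]addrC [F South + _]addrC [RHS]addrA.
Qed.

Lemma delta_sum (V : lmodType R) (a : 'I_p.+1) (F : 'I_p.+1 -> V) :
  \sum_i delta R i a *: F i = F a.
Proof.
rewrite (bigD1 a)//= /delta eqxx scale1r big1 ?addr0// => i /negPf->.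
by rewrite scale0r.
Qed.

Lemma delta_sum_const (V : lmodType R) (a : 'I_p.+1) (F : 'I_p.+1 -> V) :
  \sum_j \sum_i delta R i a *: F j = \sum_j F j.
Proof. by apply: eq_bigr => j _; rewrite (delta_sum _ (fun=> F j)). Qed.

(** For p >= 1, the number of sides through a node: 0 inside the cell, 1 on an open side, 2 at a
    corner. *)
Definition sides_at (i j : 'I_p.+1) : R :=
  delta R j ord0 + delta R i ord_max + delta R j ord_max + delta R i ord0.

Lemma sides_at_le2 (i j : 'I_p.+1) : (0 < p)%N -> sides_at i j <= 2.
Proof.
move=> p0; rewrite /sides_at /delta.
have d (k : 'I_p.+1) : (k == ord0)%:R + (k == ord_max)%:R <= 1 :> R.
  have [->|_] := eqVneq k ord0; last by rewrite add0r; case: (_ == _).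
  have -> : (ord0 : 'I_p.+1) == ord_max = false.
    by apply/negP => /eqP/(congr1 val) /= e; rewrite -e in p0.
  by rewrite addr0.
have := d i; have := d j; lra.
Qed.

(** Each node hands half of its value to every side through it and keeps the rest, which is zero at
    corners. *)
Lemma split_sides (V : lmodType R) (G : 'I_p.+1 -> 'I_p.+1 -> V) :
  \sum_i \sum_j G i j = \sum_i \sum_j (1 - sides_at i j / 2) *: G i j
  + \sum_e \sum_l 2^-1 *: G (side_node e l).1 (side_node e l).2.
Proof.
rewrite big_side /=.
transitivity (\sum_i \sum_j (1 - sides_at i j / 2) *: G i j +
  \sum_i \sum_j (sides_at i j / 2) *: G i j).
  rewrite -big_split; apply: eq_bigr => i _; rewrite -big_split; apply: eq_bigr => j _.
  by rewrite /= -scalerDl subrK scale1r.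
congr (_ + _).
have s1 a : \sum_i \sum_j delta R j a *: (2^-1 *: G i j) = \sum_l 2^-1 *: G l a.
  by apply: eq_bigr => i _; rewrite delta_sum.
have s2 a : \sum_i \sum_j delta R i a *: (2^-1 *: G i j) = \sum_l 2^-1 *: G a l.
  by rewrite exchange_big /=; apply: eq_bigr => j _; rewrite delta_sum.
rewrite -!s1 -!s2 -!big_split; apply: eq_bigr => i _; rewrite -!big_split /=.
by apply: eq_bigr => j _; rewrite -scalerA -!scalerDl.
Qed.

Lemma sum_split6 (V : zmodType) (F A B C D E G : 'I_p.+1 -> 'I_p.+1 -> V) :
  (forall i j, F i j = A i j + B i j + (C i j + D i j) + (E i j + G i j)) ->
  \sum_i \sum_j F i j = \sum_j \sum_i A i j + \sum_i \sum_j B i j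
   + (\sum_i \sum_j C i j + \sum_i \sum_j D i j)
   + (\sum_j \sum_i E i j + \sum_j \sum_i G i j).
Proof.
move=> h; rewrite [\sum_j \sum_i A i j]exchange_big.
rewrite [\sum_j \sum_i E i j]exchange_big [\sum_j \sum_i G i j]exchange_big /=.
rewrite -!big_split; apply: eq_bigr => i _ /=.
by rewrite -!big_split; apply: eq_bigr => j _.
Qed.

Lemma addr_pairs (V : zmodType) (a b c d a' b' c' d' : V) :
  (a + b) + (c + d) + (c' + d') + (a' + b')
  = (d + d') + (a + a') + (c + c') + (b + b').
Proof.
rewrite -[LHS]addrA -[LHS]addrA [(c' + d') + _]addrC [(c + d) + _]addrCA [LHS]addrA.
rewrite [(a + b) + _]addrACA [(c + d) + _]addrACA [LHS]addrC.
by rewrite [(c + c') + _]addrC addrACA addrA.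
Qed.

(** Bookkeeping for the residual: A and B are the volume terms in the two directions, K what each
    line of nodes leaves at its two ends, and D the interface terms. *)
Lemma sum_over_sides (V : lmodType R) (w : 'I_p.+1 -> R)
    (F A B : 'I_p.+1 -> 'I_p.+1 -> V) (K D : side -> 'I_p.+1 -> V) :
  (forall i j, F i j = w j *: A j i + w i *: B i j +
     (delta R j ord_max *: (w i *: D North i) + delta R j ord0 *: (w i *: D South i)) +
     (delta R i ord_max *: (w j *: D East j) + delta R i ord0 *: (w j *: D West j))) ->
  (forall j, \sum_i A j i = K East j + K West j) ->
  (forall i, \sum_j B i j = K North i + K South i) ->
  \sum_i \sum_j F i j = \sum_e \sum_l w l *: (K e l + D e l).
Proof.
move=> hF hA hB; rewrite (sum_split6 hF) !delta_sum_const big_side.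
have KD e : \sum_l w l *: (K e l + D e l) = \sum_l w l *: K e l + \sum_l w l *: D e l.
  by rewrite -big_split; apply: eq_bigr => l _; rewrite scalerDr.
rewrite !KD -addr_pairs; congr (_ + _ + _ + _); rewrite -big_split.
  by apply: eq_bigr => j _; rewrite -scaler_sumr hA scalerDr.
by apply: eq_bigr => i _; rewrite -scaler_sumr hB scalerDr.
Qed.

Lemma volume_split (V : lmodType R) (a b : R) (c d : 'I_p.+1 -> R)
    (F G : 'I_p.+1 -> V) :
  (2 * a * b) *: (\sum_l c l *: F l + \sum_l d l *: G l) =
  b *: (\sum_l (2 * a * c l) *: F l) + a *: (\sum_l (2 * b * d l) *: G l).
Proof.
rewrite scalerDr !scaler_sumr; congr (_ + _); apply: eq_bigr => l _;
  by rewrite !scalerA; congr (_ *: _); ring.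
Qed.

Lemma scale_pair (V : lmodType R) (a b c : R) (x y : V) :
  a *: (b *: x + c *: y) = b *: (a *: x) + c *: (a *: y).
Proof. by rewrite scalerDr !scalerA ![a * _]mulrC. Qed.

Lemma scaler_upwind (V : lmodType R) (b a : R) (x y : V) :
  b *: (a *: x + a *: (y - x)) = (b * a) *: y.
Proof. by rewrite -scalerDr addrC subrK scalerA. Qed.

Lemma scaler_minus (V : lmodType R) (a b c d f mu : R) (x y : V) :
  a * b = f -> c * d = f * mu -> a *: (b *: x) - c *: (d *: y) = f *: (x - mu *: y).
Proof. by move=> <- e; rewrite scalerBr !scalerA e. Qed.

End BoundarySums.

(** * The residual summed over a cell *)

Section Residual.
Variables (R : realType) (m : nat) (Cv gammai : 'I_m.+1 -> R) (gam : R).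
Hypotheses (hCv : forall i, 0 < Cv i) (hgammai : forall i, 1 < gammai i).
Hypothesis hgam : forall i, gammai i < gam.
Variable p : nat.
Hypothesis hp : (1 <= p)%N.
Variables xi w : 'I_p.+1 -> R.
Hypothesis hGL : gauss_lobatto xi w.
Variable X : mesh R.
Variable U : nodal m p X.
Hypothesis hU : forall k i j, admissible (U k i j).

Let xi0 : xi ord0 = -1. Proof. by case: hGL. Qed.
Let xip : xi ord_max = 1. Proof. by case: hGL. Qed.
Let w_gt0 i : 0 < w i. Proof. by case: hGL. Qed.

Lemma node_jac_gt0 (k : cell X) i j : 0 < node_jac xi k i j.
Proof. by apply: mesh_jac; exact: (node_bound hGL). Qed.

Lemma geom_jac (k : cell X) s t : -1 <= s <= 1 -> -1 <= t <= 1 ->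
  0 < Jdet (geom k) s t.
Proof. exact: mesh_jac. Qed.

Lemma reindexK (k : cell X) e (l : 'I_p.+1) : Defs.reindex k e (Defs.reindex k e l) = l.
Proof. by rewrite /Defs.reindex; case: (flip k e); rewrite ?rev_ordK. Qed.

(** Indexed by the cell's own coordinate along the side, whereas [trace_out] expects the index along
    the shared edge parametrization; [reindex] converts. *)
Definition side_flux (k : cell X) (e : side) (l : 'I_p.+1) : state R m :=
  hflux Cv gammai gam (U k (side_node e l).1 (side_node e l).2)
    (trace_out U k e (Defs.reindex k e l)) (side_normal (geom k) e).

Lemma side_dE (k : cell X) e l : side_d Cv gammai gam U k e l =
  (side_len (geom k) e / 2) *: (side_flux k e l -
    flux Cv gammai (U k (side_node e l).1 (side_node e l).2) (side_normal (geom k) e)).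
Proof. by rewrite /side_d /edge_d /side_flux /trace_in /edge_node reindexK. Qed.

(** On a straight side the metric vector is the unit normal times |e|/2, the very factor J_e of the
    interface terms. This match, up to sign on the opposite side, makes the boundary fluxes
    cancel. *)
Lemma node_Jgrad_xi_East (k : cell X) j : node_Jgrad_xi xi k ord_max j =
  (side_len (geom k) East / 2) *: side_normal (geom k) East.
Proof.
rewrite /node_Jgrad_xi Jgrad_xiE ?node_jac_gt0// xip deta_end.
by rewrite side_normalE//; exact: geom_jac.
Qed.

Lemma node_Jgrad_xi_West (k : cell X) j : node_Jgrad_xi xi k ord0 j =
  (- (side_len (geom k) West / 2)) *: side_normal (geom k) West.
Proof.
rewrite /node_Jgrad_xi Jgrad_xiE ?node_jac_gt0// xi0 deta_start.
by rewrite -scaleN1r rotcwZ scaleN1r scaleNr side_normalE//; exact: geom_jac.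
Qed.

Lemma node_Jgrad_eta_North (k : cell X) i : node_Jgrad_eta xi k i ord_max =
  (side_len (geom k) North / 2) *: side_normal (geom k) North.
Proof.
rewrite /node_Jgrad_eta Jgrad_etaE ?node_jac_gt0// xip dxi_end.
by rewrite -[- (2^-1 *: _)]scaleN1r rotcwZ scaleN1r opprK side_normalE//; exact: geom_jac.
Qed.

Lemma node_Jgrad_eta_South (k : cell X) i : node_Jgrad_eta xi k i ord0 =
  (- (side_len (geom k) South / 2)) *: side_normal (geom k) South.
Proof.
rewrite /node_Jgrad_eta Jgrad_etaE ?node_jac_gt0// xi0 dxi_start.
by rewrite scaleNr side_normalE//; exact: geom_jac.
Qed.

(** Along each line of nodes the volume terms reduce to J_e f(u^-).n at both ends, which the same
    term inside [edge_d] removes. Only the interface fluxes remain. *)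
Lemma residual_sum (k : cell X) :
  \sum_i \sum_j residual Cv gammai gam xi w U k i j =
  \sum_e \sum_l (w l * (side_len (geom k) e / 2)) *: side_flux k e l.
Proof.
pose f e l := flux Cv gammai (U k (side_node e l).1 (side_node e l).2)
  (side_normal (geom k) e).
pose L e := side_len (geom k) e / 2.
pose Hx j i l := hec Cv gammai (U k i j) (U k l j)
  (avg (node_Jgrad_xi xi k i j) (node_Jgrad_xi xi k l j)).
pose Hy i j l := hec Cv gammai (U k i j) (U k i l)
  (avg (node_Jgrad_eta xi k i j) (node_Jgrad_eta xi k i l)).
have HxC j i l : Hx j i l = Hx j l i.
  by rewrite /Hx hecC (avgC (node_Jgrad_xi xi k i j)).
have HyC i j l : Hy i j l = Hy i l j.
  by rewrite /Hy hecC (avgC (node_Jgrad_eta xi k i j)).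
have HE j : Hx j ord_max ord_max = L East *: f East j.
  by rewrite /Hx avgxx (hec_consistent hCv hgammai)// node_Jgrad_xi_East fluxZ.
have HW j : Hx j ord0 ord0 = - (L West *: f West j).
  rewrite /Hx avgxx (hec_consistent hCv hgammai)// node_Jgrad_xi_West fluxZ.
  by rewrite scaleNr.
have HN i : Hy i ord_max ord_max = L North *: f North i.
  by rewrite /Hy avgxx (hec_consistent hCv hgammai)// node_Jgrad_eta_North fluxZ.
have HS i : Hy i ord0 ord0 = - (L South *: f South i).
  rewrite /Hy avgxx (hec_consistent hCv hgammai)// node_Jgrad_eta_South fluxZ.
  by rewrite scaleNr.
have vx j : \sum_i \sum_l (2 * w i * Dmat xi i l) *: Hx j i l =
    L East *: f East j + L West *: f West j.
  by rewrite (sbp_sum hp hGL (HxC j)) HE HW opprK.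
have vy i : \sum_j \sum_l (2 * w j * Dmat xi j l) *: Hy i j l =
    L North *: f North i + L South *: f South i.
  by rewrite (sbp_sum hp hGL (HyC i)) HN HS opprK.
pose dd e l := L e *: (side_flux k e l - f e l).
have split4 i j : residual Cv gammai gam xi w U k i j =
   w j *: (\sum_l (2 * w i * Dmat xi i l) *: Hx j i l) +
   w i *: (\sum_l (2 * w j * Dmat xi j l) *: Hy i j l) +
   (delta R j ord_max *: (w i *: dd North i) + delta R j ord0 *: (w i *: dd South i)) +
   (delta R i ord_max *: (w j *: dd East j) + delta R i ord0 *: (w j *: dd West j)).
  by rewrite /residual volume_split !scale_pair !side_dE.
apply: (etrans (sum_over_sides split4 vx vy)).
apply: eq_bigr => e _; apply: eq_bigr => l _.
exact: scaler_upwind.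
Qed.

End Residual.

(** * Cell averages and stationary interfaces *)

Section Scheme.
Variables (R : realType) (m : nat) (Cv gammai : 'I_m.+1 -> R) (gam : R).
Hypotheses (hCv : forall i, 0 < Cv i) (hgammai : forall i, 1 < gammai i).
Hypothesis hgam : forall i, gammai i < gam.
Variable p : nat.
Hypothesis hp : (1 <= p)%N.
Variables xi w : 'I_p.+1 -> R.
Hypothesis hGL : gauss_lobatto xi w.
Variable X : mesh R.

Let w_gt0 i : 0 < w i. Proof. by case: hGL. Qed.

Lemma node_weight (e : side) (l : 'I_p.+1) :
  w (side_node e l).1 * w (side_node e l).2 = 2 / (p * p.+1)%:R * w l.
Proof.
by case: e; rewrite /= ?(w_end hp hGL (i := ord0)) ?(w_end hp hGL (i := ord_max))
  ?eqxx ?orbT// mulrC.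
Qed.

(** The CFL quotient dominates |e| lam / J at every edge node: the perimeters of the triangle and of
    the cell are at least |e|, and [Jtilde] is at most the nodal Jacobian. The factor p (p + 1)
    comes from dividing by the endpoint weight. *)
Lemma side_speed_bound (U : nodal m p X) (dt : R) (ctr : cell X -> 'rV[R]_2) k e l i j :
  (forall k i j, admissible (U k i j)) -> 0 < dt ->
  cfl Cv gammai gam xi U dt ctr -> side_node e l = (i, j) ->
  2 * (dt * side_len (geom k) e / (2 / (p * p.+1)%:R * node_jac xi k i j) *
    wave_speedL Cv gammai gam (U k i j) (trace_out U k e (Defs.reindex k e l))
      (side_normal (geom k) e)) < 1.
Proof.
move=> hU dt0 hcfl hij.
have hk : dt * cfl_cell Cv gammai gam xi U ctr k < 1 / (2 * p * p.+1)%:R.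
  rewrite -lte_fin; apply: le_lt_trans hcfl.
  rewrite EFinM lee_wpmul2l ?lee_fin//; first exact: ltW.
  by apply: ereal_sup_ubound; exists k.
set uo := trace_out _ _ _ _; set n := side_normal _ _.
set lam := wave_speedL _ _ _ _ _ _.
set l' := Defs.reindex k e l.
have [_ r0 _] := hU k i j.
have lam0 : 0 <= lam.
  have huo : admissible uo by exact: hU.
  have [h _ _ _] := lag_speeds_bounds hCv hgammai hgam n (hU k i j) huo.
  rewrite /lam /wave_speedL addr_ge0// divr_ge0 ?(ltW r0)//; apply: le_trans h.
  by rewrite mulr_ge0 ?(ltW r0)// sqrtr_ge0.
have sp : lam <= edge_speed Cv gammai gam U k e l'.
  by rewrite /edge_speed /trace_in /edge_node /= reindexK hij le_max lexx.
have jn : edge_jac xi k e l' = node_jac xi k i j by rewrite /edge_jac /edge_node reindexK hij.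
have J0 : 0 < node_jac xi k i j by exact: (node_jac_gt0 hGL).
have Jt0 : 0 < Jtilde xi k l'.
  by apply: lt_bigmin => [|e' _]; exact: (node_jac_gt0 hGL).
have Jt : Jtilde xi k l' <= node_jac xi k i j by rewrite -jn; exact: bigmin_le.
have len0 : 0 < side_len (geom k) e by apply: side_len_gt0; exact: geom_jac.
have per : side_len (geom k) e <= perimeter (geom k).
  by rewrite /perimeter (bigD1 e)//= lerDl sumr_ge0// => ? _; exact: enorm_ge0.
have tri : 1 <= tri_perimeter (geom k) (ctr k) e / side_len (geom k) e.
  rewrite ler_pdivlMr// mul1r /tri_perimeter -addrA lerDl.
  by rewrite addr_ge0// enorm_ge0.
have cell_bound : side_len (geom k) e * lam / node_jac xi k i j
    <= cfl_cell Cv gammai gam xi U ctr k.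
  apply: le_trans (le_bigmax _ _ e).
  set Mx := \big[_/_]_(_ < _) _.
  have hM : perimeter (geom k) / Jtilde xi k l' * edge_speed Cv gammai gam U k e l' <= Mx.
    exact: (le_bigmax _ (fun l => perimeter (geom k) / Jtilde xi k l *
      edge_speed Cv gammai gam U k e l)).
  have h1 : side_len (geom k) e * lam / node_jac xi k i j <= Mx.
    apply: le_trans hM; rewrite mulrAC.
    apply: ler_pM => //; first by rewrite divr_ge0 ?(ltW len0) ?(ltW J0).
    by apply: ler_pM; rewrite ?invr_ge0 ?(ltW len0) ?(ltW J0) ?lef_pV2 ?posrE.
  apply: (le_trans h1); rewrite ler_peMl//.
  by apply: le_trans h1; rewrite divr_ge0 ?mulr_ge0// ltW.
have p0 : 0 < (p * p.+1)%:R :> R by rewrite ltr0n muln_gt0 hp.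
have {hk cell_bound} : dt * (side_len (geom k) e * lam / node_jac xi k i j)
    < 1 / (2 * p * p.+1)%:R.
  by apply: le_lt_trans hk; rewrite ler_pM2l.
rewrite -mulnA natrM; move: (_%:R) p0 (node_jac xi k i j) J0 => P P0 J J0 h.
have -> : 2 * (dt * side_len (geom k) e / (2 / P * J) * lam) =
    P * (dt * (side_len (geom k) e * lam / J)) by field; rewrite !gt_eqF.
have -> : 1 = P * (1 / P) by field; rewrite gt_eqF.
rewrite ltr_pM2l//; apply: (lt_trans h).
by rewrite ltr_pM2l// ltf_pV2 ?posrE//; lra.
Qed.

Lemma dgsem_stepE (U U' : nodal m p X) (dt : R) k i j : 0 < dt ->
  dgsem_step Cv gammai gam xi w dt U U' ->
  (w i * w j * node_jac xi k i j) *: U' k i j =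
  (w i * w j * node_jac xi k i j) *: U k i j - dt *: residual Cv gammai gam xi w U k i j.
Proof.
move=> dt0 /(_ k i j) /eqP; rewrite addr_eq0 => /eqP h.
rewrite -[residual _ _ _ _ _ _ _ _ _]opprK -h scalerN opprK !scalerA.
rewrite [dt * _]mulrC mulfK ?gt_eqF//.
by rewrite scalerBr addrC subrK.
Qed.

Lemma cell_avgE (U : nodal m p X) k : cell_avg xi w U k = (cell_size xi w k)^-1 *:
  \sum_i \sum_j (w i * w j * node_jac xi k i j) *: U k i j.
Proof.
rewrite /cell_avg scaler_sumr; apply: eq_bigr => i _; rewrite scaler_sumr.
by apply: eq_bigr => j _; rewrite scalerA mulrA [_^-1 * _]mulrC.
Qed.

Lemma cell_size_gt0 (k : cell X) : 0 < cell_size xi w k.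
Proof.
have pos i j : 0 < w i * w j * node_jac xi k i j.
  by rewrite !mulr_gt0// (node_jac_gt0 hGL).
rewrite /cell_size (bigD1 ord0)//= ltr_pwDl//; last first.
  by rewrite sumr_ge0// => i _; rewrite sumr_ge0// => j _; exact: ltW.
rewrite (bigD1 ord0)//= ltr_pwDl// sumr_ge0// => j _; exact: ltW.
Qed.

Lemma cell_avg_admissible (U U' : nodal m p X) (dt : R) (ctr : cell X -> 'rV[R]_2) k :
  (forall k i j, admissible (U k i j)) -> 0 < dt ->
  cfl Cv gammai gam xi U dt ctr ->
  dgsem_step Cv gammai gam xi w dt U U' ->
  admissible (cell_avg xi w U' k).
Proof.
move=> hU dt0 hcfl step; rewrite cell_avgE.
apply: admissibleZ; first by rewrite invr_gt0 cell_size_gt0.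
pose G i j : state R m := (w i * w j * node_jac xi k i j) *: U k i j.
(* Half of the nodal value is set against a full interface flux, since a corner node has to serve
   two sides. *)
pose Z e l : state R m := 2^-1 *: G (side_node e l).1 (side_node e l).2
  - dt *: ((w l * (side_len (geom k) e / 2)) *: side_flux Cv gammai gam U k e l).
have -> : \sum_i \sum_j (w i * w j * node_jac xi k i j) *: U' k i j =
    \sum_e \sum_l Z e l + \sum_i \sum_j (1 - sides_at R i j / 2) *: G i j.
  transitivity (\sum_i \sum_j G i j
      - dt *: \sum_i \sum_j residual Cv gammai gam xi w U k i j).
    rewrite scaler_sumr -sumrB; apply: eq_bigr => i _.
    rewrite scaler_sumr -sumrB; apply: eq_bigr => j _; exact: dgsem_stepE.
  rewrite residual_sum// split_sides.
  rewrite [RHS]addrC -addrA; congr (_ + _).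
  rewrite scaler_sumr -sumrB; apply: eq_bigr => e _.
  by rewrite scaler_sumr -sumrB.
apply: admissibleDl.
  apply: (admissible_sum South) => e; apply: (admissible_sum ord0) => l.
  set i := (side_node e l).1; set j := (side_node e l).2.
  pose om : R := 2 / (p * p.+1)%:R.
  have om0 : 0 < om by rewrite divr_gt0// ltr0n muln_gt0 hp.
  have J0 : 0 < node_jac xi k i j by exact: (node_jac_gt0 hGL).
  (* Quotient of the flux coefficient dt w_l |e| / 2 by the half mass om w_l J / 2 of the node. *)
  pose mu := dt * side_len (geom k) e / (om * node_jac xi k i j).
  have -> : Z e l = (om * w l * node_jac xi k i j / 2) *:
      (U k i j - mu *: side_flux Cv gammai gam U k e l).
    rewrite /Z /G -/i -/j node_weight -/om; apply: scaler_minus.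
      by rewrite mulrC.
    by rewrite /mu; field; rewrite !gt_eqF.
  apply: admissibleZ.
    by apply: divr_gt0 => //; apply: mulr_gt0 => //; exact: mulr_gt0.
  apply: (admissible_minus_hflux hCv hgammai hgam) => //.
  - by apply: side_normal_unit; exact: geom_jac.
  - by exact: hU.
  - apply: divr_ge0; last exact: mulr_ge0 (ltW om0) (ltW J0).
    exact: mulr_ge0 (ltW dt0) (enorm_ge0 _).
  - have hij : side_node e l = (i, j) by rewrite /i /j; case: (side_node e l).
    exact: (side_speed_bound k hU dt0 hcfl hij).
(* The leftover weights 1 - [sides_at] / 2 are nonnegative but vanish at corners, hence
   [admissible0]. *)
apply: admissible0_sum => i; apply: admissible0_sum => j.
apply: admissible0Z; last first.
  by right; apply: admissibleZ => //; rewrite !mulr_gt0// (node_jac_gt0 hGL).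
by have := sides_at_le2 R i j hp; lra.
Qed.

(** * Stationary material interfaces *)

Lemma pressure_fluxD (pr : R) (a b : 'rV[R]_2) :
  pressure_flux m pr (a + b) = pressure_flux m pr a + pressure_flux m pr b.
Proof.
by rewrite /pressure_flux scalerDr; apply: state_eq => //;
  rewrite ?[RHS]addr0.
Qed.

Lemma pressure_fluxZ (pr c : R) (a : 'rV[R]_2) :
  pressure_flux m pr (c *: a) = c *: pressure_flux m pr a.
Proof.
rewrite /pressure_flux scalerA mulrC -scalerA; apply: state_eq => //.
- exact: (esym (scaler0 _ _)).
- exact: (esym (mulr0 _)).
- exact: (esym (mulr0 _)).
Qed.

Lemma pressure_flux_avg (pr x y : R) (a b : 'rV[R]_2) :
  pressure_flux m pr (avg (a + x *: b) (a + y *: b)) =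
  avg (pressure_flux m pr a + x *: pressure_flux m pr b)
      (pressure_flux m pr a + y *: pressure_flux m pr b).
Proof. by rewrite /avg pressure_fluxZ !pressure_fluxD !pressure_fluxZ. Qed.

(** The numerical and exact fluxes at a side are both the pressure flux, so the interface terms
    vanish. The volume terms are linear in the metric vectors, whose slopes in xi and eta are
    opposite, and cancel. *)
Lemma residual_rest (U : nodal m p X) (pr : R) k i j :
  (forall k i j, admissible (U k i j)) ->
  (forall k i j, vel (U k i j) = 0) ->
  (forall k i j, pressure Cv gammai (U k i j) = pr) ->
  residual Cv gammai gam xi w U k i j = 0.
Proof.
move=> hU hv hpr.
have sd e l : side_d Cv gammai gam U k e l = 0.
  rewrite /side_d /edge_d (hflux_rest hCv hgammai hgam (pr := pr))//; first last.
  - by apply: side_normal_unit; exact: geom_jac.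
  - exact: hpr.
  - exact: hpr.
  - exact: hv.
  - exact: hv.
  - exact: hU.
  - exact: hU.
  rewrite (flux_rest (pr := pr)); [|exact: hv|exact: hpr].
  by rewrite subrr scaler0.
(* The rotated mixed derivative of the bilinear map: J grad xi has slope s in xi, and J grad eta has
   slope -s in eta. *)
pose s : 'rV[R]_2 := rotcw (4^-1 *: (geom k true true - geom k false true
  - geom k true false + geom k false false)).
have gx i' j' : node_Jgrad_xi xi k i' j' = rotcw (deta (geom k) 0) + xi i' *: s.
  rewrite /node_Jgrad_xi Jgrad_xiE ?(node_jac_gt0 hGL)//.
  by rewrite deta_affine rotcwD (rotcwZ (xi i')).
have gy i' j' : node_Jgrad_eta xi k i' j' = - rotcw (dxi (geom k) 0) + xi j' *: - s.
  rewrite /node_Jgrad_eta Jgrad_etaE ?(node_jac_gt0 hGL)//.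
  rewrite dxi_affine rotcwD (rotcwZ (xi j')).
  by rewrite opprD scalerN.
have hr i1 j1 i2 j2 n : hec Cv gammai (U k i1 j1) (U k i2 j2) n = pressure_flux m pr n.
  by apply: hec_rest.
have hx : \sum_l Dmat xi i l *: hec Cv gammai (U k i j) (U k l j)
    (avg (node_Jgrad_xi xi k i j) (node_Jgrad_xi xi k l j)) =
    2^-1 *: pressure_flux m pr s.
  rewrite -(Dmat_avg_affine hp hGL (pressure_flux m pr (rotcw (deta (geom k) 0))) _ i).
  apply: eq_bigr => l _; congr (_ *: _).
  by rewrite hr !gx pressure_flux_avg.
have hy : \sum_l Dmat xi j l *: hec Cv gammai (U k i j) (U k i l)
    (avg (node_Jgrad_eta xi k i j) (node_Jgrad_eta xi k i l)) =
    2^-1 *: pressure_flux m pr (- s).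
  rewrite -(Dmat_avg_affine hp hGL (pressure_flux m pr (- rotcw (dxi (geom k) 0))) _ j).
  apply: eq_bigr => l _; congr (_ *: _).
  by rewrite hr !gy pressure_flux_avg.
rewrite /residual hx hy !sd !scaler0 !addr0 !scaler0 !addr0.
rewrite -scalerDr -pressure_fluxD subrr /pressure_flux scaler0.
by rewrite -[((0, 0), 0, 0)]/(0 : state R m) !scaler0.
Qed.

Lemma step_rest (U U' : nodal m p X) (dt pr : R) k i j : 0 < dt ->
  (forall k i j, admissible (U k i j)) ->
  (forall k i j, vel (U k i j) = 0) ->
  (forall k i j, pressure Cv gammai (U k i j) = pr) ->
  dgsem_step Cv gammai gam xi w dt U U' -> U' k i j = U k i j.
Proof.
move=> dt0 hU hv hpr /(dgsem_stepE k i j dt0).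
rewrite (residual_rest _ _ _ hU hv hpr) scaler0 subr0; apply: scalerI.
by rewrite gt_eqF// !mulr_gt0// (node_jac_gt0 hGL).
Qed.

End Scheme.

Theorem theorem6p1 (R : realType) (m : nat) (hm : (2 <= m.+1)%N)
  (Cv gammai : 'I_m.+1 -> R)
  (hCv : forall i, 0 < Cv i) (hgammai : forall i, 1 < gammai i)
  (gam : R) (hgam : forall i, gammai i < gam)
  (p : nat) (hp : (1 <= p)%N)
  (xi w : 'I_p.+1 -> R) (hGL : gauss_lobatto xi w)
  (X : mesh R) (ctr : cell X -> 'rV[R]_2)
  (hctr : forall k, in_open_quad (geom k) (ctr k))
  (dt : nat -> R) (hdt : forall n, 0 < dt n)
  (U : nat -> nodal m p X)
  (hU : forall n, dgsem_step Cv gammai gam xi w (dt n) (U n) (U n.+1)) :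
  (forall n : nat,
     (forall k i j, admissible (U n k i j)) ->
     cfl Cv gammai gam xi (U n) (dt n) ctr ->
     forall k, admissible (cell_avg xi w (U n.+1) k))
  /\
  (forall (OmegaL OmegaR : set 'rV[R]_2) (u0 : 'rV[R]_2 -> state R m)
     (YL YR : 'rV[R]_m) (rhoL rhoR pr : R),
     closure OmegaL `|` closure OmegaR = [set: 'rV[R]_2] ->
     (forall x, admissible (u0 x)) ->
     (forall x, OmegaL x -> is_prim Cv gammai (u0 x) YL rhoL 0 pr) ->
     (forall x, OmegaR x -> is_prim Cv gammai (u0 x) YR rhoR 0 pr) ->
     (forall x, is_prim Cv gammai (u0 x) YL rhoL 0 pr \/
                is_prim Cv gammai (u0 x) YR rhoR 0 pr) ->
     (forall k i j, U 0%N k i j = u0 (node_pt xi k i j)) ->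
     forall n k i j, U n k i j = u0 (node_pt xi k i j)).
Proof.
split=> [n hUn hcfl k|OL OR u0 YL YR rhoL rhoR pr _ adm _ _ prim h0].
  exact: (cell_avg_admissible hCv hgammai hgam hp hGL k hUn (hdt n) hcfl (hU n)).
elim=> [|n IH] k i j; first exact: h0.
(* By induction the nodal values at step n are the initial ones, so every node is at rest with
   pressure [pr] whichever side of the interface it lies on. *)
rewrite -IH; apply: (step_rest hCv hgammai hgam hp hGL (pr := pr) _ _ _ (hdt n) _ _ _ (hU n)).
- by move=> k' i' j'; rewrite IH; exact: adm.
- by move=> k' i' j'; rewrite IH; case: (prim (node_pt xi k' i' j')) => -[].
- by move=> k' i' j'; rewrite IH; case: (prim (node_pt xi k' i' j')) => -[].
Qed.
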